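(* Let $n\ge 0$ and $d>2$ be integers, and let $f$ be a homogeneous complex polynomial of degree $d$ in $x_0,\dots,x_n$ such that the partial derivatives $\partial f/\partial x_0,\dots,\partial f/\partial x_n$ have no common zero in $\mathbb C^{n+1}\setminus\{0\}$. Then the order of the subgroup $\{A\in\mathrm{GL}_{n+1}(\mathbb C): f\circ A=f\}$ divides $$\prod_{i=0}^n\big((-1)^{n-i}+(d-1)^{n-i+1}\big)(d-1)^i.$$ *)

(* Defs.v *)
From HB Require Import structures.
From mathcomp Require Import all_boot all_order all_algebra.
From mathcomp Require Import complex.
From mathcomp Require Import Rstruct.
From mathcomp Require Import mpoly.
From Stdlib Require Import Reals.

Set Implicit Arguments.
Unset Strict Implicit.
Unset Printing Implicit Defensive.

Import Order.TTheory GRing.Theory Num.Theory.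
Local Open Scope ring_scope.

Definition CC : Type := complex Rdefinitions.R.

Definition lin_subst (m : nat) (A : 'M[CC]_m) : m.-tuple {mpoly CC[m]} :=
  [tuple \sum_(j < m) A i j *: 'X_j | i < m].

Definition comp_lin (m : nat) (f : {mpoly CC[m]}) (A : 'M[CC]_m) : {mpoly CC[m]} :=
  f \mPo lin_subst A.

Definition bound (n d : nat) : int :=
  \prod_(i < n.+1)
     (((-1) ^+ (n - i) + ((d%:Z - 1) ^+ (n - i + 1))) * (d%:Z - 1) ^+ i).

(* Main.v *)
(** A finite group [G] of linear maps preserving a smooth form [f] of degree
    [d = e + 1] acts on [V] so that [g |-> (1 - d) ^ dim V^g] is a virtual
    character: up to a sign and the determinant it is the value at [t = 1] of
    [det (1 - t^e g^-1) / det (1 - t g)], the graded character of the Milnor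
    algebra of [f].  This quotient is a polynomial in [t] because the gradient of
    [f] restricts to a map from the [z]-eigenspace of [g] to the dual of its
    [z^-e]-eigenspace that vanishes only at the origin, so the first eigenspace
    has at most the dimension of the second.  With [q = 1 - d] and [m = n + 1],
    the virtual character [g |-> prod_(j < m) (q ^ dim V^g - q ^ j)] vanishes for
    [g <> 1]; its scalar product with the trivial character is an integer, so
    [#|G|] divides its value [prod_(j < m) (q ^ m - q ^ j)] at [1], which is the
    bound up to sign.

    For the finiteness of the stabilizer, the same equivariance of the gradient
    makes the set of eigenvalues of every element stable under [z |-> z^-e],
    which bounds the exponent, and Burnside's trace argument applies. *)

Require Import Defs.
From HB Require Import structures.
From mathcomp Require Import all_boot all_order all_algebra.
From mathcomp Require Import complex Rstruct mpoly.
From mathcomp Require Import mxtens separable zify ring.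
From Stdlib Require Import Classical ClassicalEpsilon.

Set Implicit Arguments.
Unset Strict Implicit.
Unset Printing Implicit Defensive.

Import Order.TTheory GRing.Theory Num.Theory passmx.
Local Open Scope ring_scope.

(** * Spans of predicates on a finite-dimensional space *)

Section LinearAlgebra.
Variable F : fieldType.

(** Vectors of [P] outside the span are added one at a time; each raises the dimension, so the
    process stops. In the induction [k] bounds the remaining codimension. *)
Lemma finite_spanning_family (V : vectType F) (P : V -> Prop) :
  exists X : seq V, (forall v, v \in X -> P v) /\
                    (forall v, P v -> v \in <<X>>%VS).
Proof.
suff H k (X : seq V) : (forall v, v \in X -> P v) ->
    (\dim {:V} - \dim <<X>> <= k)%N ->
    exists X : seq V, (forall v, v \in X -> P v) /\
                    (forall v, P v -> v \in <<X>>%VS).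
  by apply: (H _ [::] _ (leqnn _)).
elim: k X => [|k IH] X PX dX.
  exists X; split=> // v _; suff -> : <<X>>%VS = fullv by rewrite memvf.
  by apply/eqP; rewrite eqEdim subvf /=; lia.
have [[v [Pv vX]]|H] := classic (exists v, P v /\ v \notin <<X>>%VS); last first.
  exists X; split=> // v Pv; apply: contraT => vX.
  by case: H; exists v.
apply: (IH (v :: X)) => [w|].
  by rewrite inE => /orP[/eqP->//|/PX].
have lt : (\dim <<X>> < \dim <<v :: X>>)%N.
  have sub : (<<X>> <= <<v :: X>>)%VS by rewrite span_cons addvSr.
  rewrite ltn_neqAle dimvS // andbT; apply: contra vX => /eqP e.
  have/eqP -> : <<X>>%VS == <<v :: X>>%VS by rewrite eqEdim sub e leqnn.
  by apply: memv_span; rewrite inE eqxx.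
lia.
Qed.

(** Turns a propositional description, such as membership in an ideal, into a subspace with a
    dimension. *)
Lemma subspace_of_pred (V : vectType F) (P : V -> Prop) :
    P 0 -> (forall a u v, P u -> P v -> P (a *: u + v)) ->
  exists U : {vspace V}, forall v, v \in U <-> P v.
Proof.
move=> P0 PD; have [X [XP PX]] := finite_spanning_family P.
exists <<X>>%VS => v; split=> [|/PX//].
rewrite -[X]in_tupleE => /coord_span ->.
elim/big_rec : _ => // i w _ Pw; apply: PD => //.
by apply: XP; rewrite mem_nth.
Qed.

End LinearAlgebra.

(** * Eigenvectors of pencils of linear maps *)

Section Pencil.
Variable F : numClosedFieldType.

Lemma lfun_eigenvector (V : vectType F) (f : 'End(V)) :
  (0 < \dim {:V})%N -> exists a v, v != 0 /\ f v = a *: v.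
Proof.
move=> dV; pose e := vbasis {:V}; have be : basis_of {:V} e by apply: vbasisP.
pose A := mxof e e f.
have [a /eigenvalueP[r rA r0]] : exists a, eigenvalue A a.
  have /closed_rootP [a rAa] : size (char_poly A) != 1%N.
    by rewrite size_char_poly eqSS -lt0n.
  by exists a; rewrite eigenvalue_root_char.
exists a, (vecof e r); split; last first.
  by rewrite (hom_vecof e be) -/A rA linearZ.
by rewrite vecof_eq0.
Qed.

(** [A] is invertible from [K] onto its image, which contains [B @: K], so [A^-1 B] is an
    endomorphism of [K] and has an eigenvector. *)
Lemma pencil_eigenvector (U W : vectType F) (A B : 'Hom(U, W))
    (K : {vspace U}) :
    (0 < \dim K)%N -> (forall v, v \in K -> A v = 0 -> v = 0) ->
    (B @: K <= A @: K)%VS ->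
  exists a v, [/\ v \in K, v != 0 & B v = a *: A v].
Proof.
move=> dK injA sBA.
pose f := (A \o projv K)%VF.
(* [L] is a right inverse of [A] on [A @: K], with values in [K]. *)
pose L := (projv K \o f^-1)%VF.
have AL w : w \in (A @: K)%VS -> A (L w) = w.
  case/memv_imgP => u uK ->; rewrite /L comp_lfunE.
  have fu : f u = A u by rewrite /f comp_lfunE projv_id.
  have : f (f^-1%VF (f u)) = f u by apply: limg_lfunVK; rewrite memv_img ?memvf.
  by rewrite {1}/f comp_lfunE fu.
pose T := (linfun (vsproj K) \o (L \o (B \o linfun (@vsval _ _ K))))%VF.
have TE v : T v = vsproj K (L (B (vsval v))).
  by rewrite /T !comp_lfunE !lfunE.
have [|a [v [v0 Tv]]] := @lfun_eigenvector (subvs_of K) T.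
  by rewrite dimvf.
exists a, (vsval v); split; rewrite ?subvsP //.
have -> : a *: A (vsval v) = A (vsval (a *: v)) by rewrite !linearZ.
rewrite -Tv TE vsprojK ?AL //.
- by apply: (subvP sBA); rewrite memv_img ?subvsP.
- by rewrite /L comp_lfunE memv_proj.
Qed.

(* Once the (non-increasing) dimensions are stationary the maps [A j] are
   bijective, and an eigenvalue of [A j ^-1 * B j] propagates to all higher
   degrees. *)
Lemma tower_eigenvector (W : nat -> vectType F)
    (A B : forall j, 'Hom(W j.+1, W j)) (K : forall j, {vspace (W j)}) D :
    (forall j, (0 < \dim (K j))%N) ->
    (forall j, (A j @: K j.+1 <= K j)%VS) ->
    (forall j, (B j @: K j.+1 <= K j)%VS) ->
    (forall j v, A j (B j.+1 v) = B j (A j.+1 v)) ->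
    (forall j v, (D <= j)%N -> v \in K j.+1 -> A j v = 0 -> v = 0) ->
  exists a D', forall j, (D' <= j)%N ->
    exists v, [/\ v \in K j.+1, v != 0 & B j v = a *: A j v].
Proof.
move=> K0 AK BK AB injA.
have dA j : (D <= j)%N -> \dim (A j @: K j.+1) = \dim (K j.+1).
  move=> Dj; apply: limg_dim_eq; apply/eqP; rewrite -subv0.
  apply/subvP => v; rewrite memv_cap memv_ker memv0 => /andP[vK /eqP Av].
  by apply/eqP; apply: (injA j).
have dK j : (D <= j)%N -> (\dim (K j.+1) <= \dim (K j))%N.
  by move=> Dj; rewrite -dA // dimvS.
have [E [DE HE]] : exists E, (D <= E)%N /\
    forall j, (E <= j)%N -> \dim (K j.+1) = \dim (K j).
  have H k j : (D <= j)%N -> (\dim (K j) <= k)%N ->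
      exists E, (D <= E)%N /\
        forall j, (E <= j)%N -> \dim (K j.+1) = \dim (K j).
    elim: k j => [|k IH] j Dj kj; first by have := K0 j; lia.
    have [[i [ji ne]]|H] :=
        classic (exists i, (j <= i)%N /\ \dim (K i.+1) <> \dim (K i)).
      apply: (IH i.+1); first by lia.
      have ij : (\dim (K i) <= \dim (K j))%N.
        elim: i ji {ne} => [|i IHi]; first by rewrite leqn0 => /eqP->.
        rewrite leq_eqVlt => /orP[/eqP->//|ji].
        by apply: leq_trans (IHi ji); apply: dK; lia.
      by have := @dK i; lia.
    exists j; split=> // i ji; apply: NNPP => ne.
    by apply: H; exists i.
  exact: (H _ D (leqnn _) (leqnn _)).
have surjA j : (E <= j)%N -> (A j @: K j.+1)%VS = K j.
  move=> Ej; apply/eqP; rewrite eqEdim AK (dA _ (leq_trans DE Ej)).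
  by rewrite HE /=.
have [a [v [vK v0 Bv]]] := @pencil_eigenvector _ _ (A E) (B E) (K E.+1)
   (K0 _) (fun v => @injA E v DE) (eq_ind_r (fun X => (_ <= X)%VS) (BK E) (surjA E (leqnn _))).
exists a, E => j; elim: j => [|j IHj].
  by rewrite leqn0 => /eqP E0; subst E; exists v.
rewrite leq_eqVlt => /orP[/eqP E0|/= Ej]; first by subst E; exists v.
have [{}v [{}vK {}v0 {}Bv]] := IHj Ej.
have : v \in (A j.+1 @: K j.+2)%VS by rewrite (surjA _ (leqW _)).

case/memv_imgP => w wK vw; exists w; split=> //.
  by apply: contra v0 => /eqP w0; rewrite vw w0 linear0.
(* By commutation [A j] sends [B w - a A w] to [B v - a A v = 0], and [A j] is injective on
   [K j.+1]. *)
apply/eqP; rewrite -subr_eq0; apply/eqP.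
apply: (injA j); first by lia.
  rewrite rpredB ?rpredZ //.
    by apply: (subvP (BK _)); rewrite memv_img.
  by apply: (subvP (AK _)); rewrite memv_img.
by rewrite linearB /= linearZ /= AB -vw Bv subrr.
Qed.

End Pencil.

(** * Homogeneous components of products *)

Section Homogeneous.
Variables (F : fieldType) (n : nat).
Implicit Types (p q l : {mpoly F[n]}).

Lemma homog_meval_scale p d (c : F) (x : 'I_n -> F) : p \is d.-homog ->
  p.@[fun i => c * x i] = c ^+ d * p.@[x].
Proof.
move=> /dhomogP hp; rewrite !mevalE mulr_sumr big_seq [RHS]big_seq.
apply: eq_bigr => m /hp hm; rewrite mulrCA; congr (_ * _).
rewrite (eq_bigr (fun i => c ^+ m i * x i ^+ m i)); last first.
  by move=> i _; rewrite exprMn.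
by rewrite big_split /= prodrXr -mdegE hm.
Qed.

Lemma pihomog_mulr_homog l q k d : l \is k.-homog ->
  pihomog mdeg (k + d) (l * q) = l * pihomog mdeg d q.
Proof.
(* The decomposition of [q] is padded with zero components so that [d] is always among the
   indices. *)
move=> hl; have hq := @pihomog_partitionE _ _ mdeg (msize q + d.+1) q (leq_addr _ _).
rewrite {1}hq mulr_sumr linear_sum /=.
have dlt : (d < msize q + d.+1)%N by lia.
rewrite (bigD1 (Ordinal dlt)) //= big1 ?addr0.
  by rewrite pihomog_dE // dhomogM ?pihomogP.
move=> i id; rewrite (@pihomog_ne0 _ _ _ (k + i)) ?eqn_add2l //.
  by rewrite dhomogM ?pihomogP.
Qed.

Lemma pihomog_mulr_homog_lt l q k d : l \is k.-homog -> (d < k)%N ->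
  pihomog mdeg d (l * q) = 0.
Proof.
move=> hl dk; have hq := @pihomog_partitionE _ _ mdeg (msize q) q (leqnn _).
rewrite hq mulr_sumr linear_sum /= big1 // => i _.
rewrite (@pihomog_ne0 _ _ _ (k + i)) //; first by lia.
by rewrite dhomogM ?pihomogP.
Qed.

Lemma mnm_split_deg (m : 'X_{1..n}) D : (D <= mdeg m)%N ->
  exists m1 m2 : 'X_{1..n}, m = (m1 + m2)%MM /\ mdeg m1 = D.
Proof.
elim: D => [_|D IH Dm]; first by exists 0%MM, m; rewrite add0m mdeg0.
have [m1 [m2 [mE m1D]]] := IH (ltnW Dm).
have : mdeg m2 != 0%N by move: Dm; rewrite mE mdegD; lia.
rewrite mdeg_eq0 => /eqP m20.
have [i mi] : exists i, m2 i != 0%N.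
  apply: NNPP => H; apply: m20; apply/mnmP => i; rewrite mnm0E; apply/eqP.
  by apply: contraT => ne; case: H; exists i.
exists (m1 + U_(i))%MM, (m2 - U_(i))%MM; split.
  by rewrite -addmA [(U_(_) + _)%MM]addmC submK ?lep1mP.
by rewrite mdegD mdeg1 m1D addn1.
Qed.

End Homogeneous.

(** * Homogeneous ideals *)

Section HomogIdeal.
Variables (F : fieldType) (n : nat).
Implicit Types (p q l : {mpoly F[n]}) (I : {mpoly F[n]} -> Prop).

Definition homog_ideal I :=
  [/\ I 0, forall p q, I p -> I q -> I (p + q),
      forall p q, I p -> I (q * p)
    & forall d p, I p -> I (pihomog mdeg d p)].

(** For an ideal [I], this is the ideal generated by [I] and [l]. *)
Definition ideal_add I l p := exists q, I (p - l * q).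

Section Theory.
Variables (I : {mpoly F[n]} -> Prop) (hI : homog_ideal I).

Lemma ideal0 : I 0. Proof. by case: hI. Qed.
Lemma idealD p q : I p -> I q -> I (p + q). Proof. by case: hI => _ H _ _; apply: H. Qed.
Lemma idealM p q : I p -> I (q * p). Proof. by case: hI => _ _ H _; apply: H. Qed.
Lemma ideal_pihomog d p : I p -> I (pihomog mdeg d p).
Proof. by case: hI => _ _ _; apply. Qed.
Lemma idealZ c p : I p -> I (c *: p).
Proof. by rewrite -mul_mpolyC; apply: idealM. Qed.
Lemma idealN p : I p -> I (- p).
Proof. by rewrite -scaleN1r; apply: idealZ. Qed.
Lemma idealB p q : I p -> I q -> I (p - q).
Proof. by move=> Ip Iq; apply: idealD => //; apply: idealN. Qed.

Lemma ideal_sum (T : Type) (r : seq T) (P : pred T) (G : T -> {mpoly F[n]}) :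
  (forall i, P i -> I (G i)) -> I (\sum_(i <- r | P i) G i).
Proof. by move=> H; elim/big_rec : _ => [|i p Pi Ip]; [exact: ideal0 | apply: idealD => //; apply: H]. Qed.

Lemma ideal_congM p p' q q' : I (p - p') -> I (q - q') -> I (p * q - p' * q').
Proof.
move=> Ip Iq; have -> : p * q - p' * q' = q * (p - p') + p' * (q - q') by ring.
by apply: idealD; apply: idealM.
Qed.

Lemma ideal_congX p p' k : I (p - p') -> I (p ^+ k - p' ^+ k).
Proof.
move=> Ip; elim: k => [|k IH]; first by rewrite subrr; apply: ideal0.
by rewrite !exprS; apply: ideal_congM.
Qed.

(** Every monomial of degree [j] is a multiple of one of degree [D]. *)
Lemma ideal_homog_mono D j : (D <= j)%N ->
  (forall p, p \is D.-homog -> I p) -> forall p, p \is j.-homog -> I p.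
Proof.
move=> Dj H p /dhomogP hp; rewrite [p]mpolyE big_seq; apply: ideal_sum => m.
move=> /hp hm; apply: idealZ.
have [m1 [m2 [-> m1D]]] : exists m1 m2 : 'X_{1..n}, m = (m1 + m2)%MM /\ mdeg m1 = D.
  by apply: mnm_split_deg; rewrite hm.
rewrite mpolyXD mulrC; apply: idealM; apply: H.
by rewrite dhomogX; apply/eqP.
Qed.

Lemma homog_ideal_add l : l \is 1.-homog -> homog_ideal (ideal_add I l).
Proof.
move=> hl; split.
- by exists 0; rewrite mulr0 subrr; apply: ideal0.
- move=> p q [p' Ip] [q' Iq]; exists (p' + q').
  have -> : p + q - l * (p' + q') = (p - l * p') + (q - l * q') by ring.
  exact: idealD.
- move=> p q [p' Ip]; exists (q * p').
  have -> : q * p - l * (q * p') = q * (p - l * p') by ring.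
  exact: idealM.
(* In degree 0 a multiple of the linear form [l] has no component; in degree [d.+1] its component is
   [l] times that of degree [d] of the cofactor. *)
- move=> [|d] p [p' Ip].
    exists 0; rewrite mulr0 subr0.
    have := ideal_pihomog 0 Ip.
    by rewrite linearB /= (@pihomog_mulr_homog_lt _ _ _ _ 1) // subr0.
  exists (pihomog mdeg d p').
  have := ideal_pihomog d.+1 Ip.
  by rewrite linearB /= -(@pihomog_mulr_homog _ _ _ _ 1).
Qed.

Lemma sub_ideal_add l p : I p -> ideal_add I l p.
Proof. by move=> Ip; exists 0; rewrite mulr0 subr0. Qed.

Lemma mem_ideal_add l : ideal_add I l l.
Proof. by exists 1; rewrite mulr1 subrr; apply: ideal0. Qed.

(** Taking components of degree [j.+1] in [p - l * q] replaces the cofactor by its component of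
    degree [j]. *)
Lemma homog_ideal_add_homog l p j : l \is 1.-homog -> p \is j.+1.-homog ->
  ideal_add I l p -> exists2 q, q \is j.-homog & I (p - l * q).
Proof.
move=> hl hp [q Iq]; exists (pihomog mdeg j q); first exact: pihomogP.
have := ideal_pihomog j.+1 Iq.
by rewrite linearB /= -(@pihomog_mulr_homog _ _ _ _ 1) // (pihomog_dE hp).
Qed.

(* Modulo [I] every variable is a multiple of [y], so the quotient is a quotient
   of the ring of polynomials in [y], supported at the point [a]. *)
Lemma ideal_eval_congr (y : {mpoly F[n]}) (a : 'I_n -> F) d p :
  (forall i, I ('X_i - a i *: y)) -> p \is d.-homog -> I (p - p.@[a] *: y ^+ d).
Proof.
move=> Ia /dhomogP hp; rewrite {1}[p]mpolyE mevalE scaler_suml -sumrB big_seq.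
apply: ideal_sum => m /hp hm; rewrite -scalerA -scalerBr; apply: idealZ.
rewrite mpolyXE_id.
have -> : (\prod_i a i ^+ m i) *: y ^+ d = \prod_i ((a i *: y) ^+ m i).
  rewrite (eq_bigr (fun i => a i ^+ m i *: y ^+ m i)); last first.
    by move=> i _; rewrite exprZn.
  by rewrite scaler_prod prodrXr -mdegE hm.
elim/big_ind2 : _ => [||i _]; first by rewrite subrr; apply: ideal0.
- by move=> *; apply: ideal_congM.
- exact: ideal_congX.
Qed.

End Theory.
End HomogIdeal.

(** * Multiplication by linear forms on graded pieces and on their duals *)

Section HomogMultiplication.
Variables (F : fieldType) (n : nat).
Local Notation V := (dhomog n.+1 F).

Definition dhomog_mul (y : V 1) j (p : V j) : V j.+1 :=
  DHomog (dhomogM (dhomog_is_dhomog y) (dhomog_is_dhomog p)).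

Lemma dhomog_mul_is_linear y j : linear (@dhomog_mul y j).
Proof.
move=> a u v; apply: val_inj => /=.
by rewrite mulrDr -scalerAr.
Qed.

HB.instance Definition _ y j :=
  GRing.isLinear.Build F (V j) (V j.+1) _ (@dhomog_mul y j)
    (@dhomog_mul_is_linear y j).

(** Transpose of multiplication by [y]; it lowers the degree. Where multiplication is onto modulo an
    ideal, its transpose is injective on the functionals that vanish on the ideal. *)
Definition dual_mul (y : V 1) j (phi : 'Hom(V j.+1, F^o)) : 'Hom(V j, F^o) :=
  (phi \o linfun (@dhomog_mul y j))%VF.

Lemma dual_mulE y j phi p : dual_mul y phi p = phi (dhomog_mul y p :> V j.+1).
Proof. by rewrite comp_lfunE lfunE. Qed.

Lemma dual_mul_is_linear y j : linear (@dual_mul y j).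
Proof. by move=> a u v; rewrite /dual_mul comp_lfunDl -comp_lfunZl. Qed.

HB.instance Definition _ y j :=
  GRing.isLinear.Build F 'Hom(V j.+1, F^o) 'Hom(V j, F^o) _ (@dual_mul y j)
    (@dual_mul_is_linear y j).

Lemma dual_mul_line (y0 y : V 1) a j (phi : 'Hom(V j.+1, F^o)) p :
  dual_mul (y - a *: y0) phi p = dual_mul y phi p - a * dual_mul y0 phi p.
Proof.
rewrite !dual_mulE.
have -> : dhomog_mul (y - a *: y0) p = dhomog_mul y p - a *: dhomog_mul y0 p.
  by apply: val_inj; rewrite /= mulrBl -scalerAl.
by rewrite linearB linearZ.
Qed.

End HomogMultiplication.

(** * A graded Nullstellensatz *)

Lemma separating_functional (F : fieldType) (V : vectType F) (U : {vspace V}) p :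
  p \notin U -> exists2 phi : 'Hom(V, F^o), phi p != 0 & forall u, u \in U -> phi u = 0.
Proof.
(* [w] is the part of [p] transverse to [U]; a coordinate that does not vanish on it, composed with
   the projection off [U], separates. *)
move=> pU; pose e := vbasis {:V}; pose w := p - projv U p.
have w0 : w != 0.
  by apply: contra pU; rewrite subr_eq0 => /eqP->; apply: memv_proj.
have [i wi] : exists i, coord e i w != 0.
  apply: NNPP => H; case/eqP: w0; rewrite (coord_vbasis (memvf w)) big1 // => i _.
  have [->|ne] := eqVneq (coord e i w) 0; first by rewrite scale0r.
  by case: H; exists i.
exists (linfun (coord e i : V -> F^o) \o (\1 - projv U))%VF.
  by rewrite comp_lfunE lfunE /= add_lfunE opp_lfunE id_lfunE.
move=> u uU.
by rewrite comp_lfunE lfunE /= add_lfunE opp_lfunE id_lfunE projv_id // subrr linear0.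
Qed.

Section Nullstellensatz.
Variables (F : numClosedFieldType) (n : nat).
Local Notation V := (dhomog n.+1 F).
Implicit Types I : {mpoly F[n.+1]} -> Prop.

Definition no_common_zero I :=
  forall x, (forall p, I p -> p.@[x] = 0) -> forall i, x i = 0.

Lemma ideal_graded_piece I j : homog_ideal I ->
  exists U : {vspace V j}, forall v, v \in U <-> I (val v).
Proof.
move=> hI; apply: subspace_of_pred; first exact: ideal0 hI.
by move=> a u v Iu Iv; rewrite linearP; apply: idealD => //; apply: idealZ.
Qed.

(** The annihilator plays the role of the dual of the degree [j] piece of the quotient by [I]. *)
Lemma annihilator_piece I j :
  exists K : {vspace 'Hom(V j, F^o)},
    forall phi, phi \in K <-> (forall p : V j, I (val p) -> phi p = 0).
Proof.
apply: subspace_of_pred => [p _|a u v Hu Hv p Ip]; first by rewrite zero_lfunE.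
by rewrite add_lfunE scale_lfunE Hu ?Hv // scaler0 addr0.
Qed.

(** Such a functional vanishes on [I] and on the multiples of [l], and together these exhaust degree
    [j.+1]. *)
Lemma annihilator_ideal_add I (l : V 1) j (phi : 'Hom(V j.+1, F^o)) :
    homog_ideal I ->
    (forall p : V j.+1, I (val p) -> phi p = 0) ->
    dual_mul l phi = 0 ->
    (forall p, p \is j.+1.-homog -> ideal_add I (val l) p) ->
  phi = 0.
Proof.
move=> hI Hphi lphi Hl; apply/lfunP => p; rewrite zero_lfunE.
have [q hq Iq] := homog_ideal_add_homog hI (dhomog_is_dhomog l)
   (dhomog_is_dhomog p) (Hl _ (dhomog_is_dhomog p)).
pose q' : V j := DHomog hq.
have -> : p = (p - dhomog_mul l q') + dhomog_mul l q' by rewrite subrK.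
by rewrite linearD /= Hphi // -dual_mulE lphi zero_lfunE addr0.
Qed.

(* Induction on the codimension of the space of linear forms in [I].  If no graded
   piece lies in [I], pick a linear form [y0] outside [I]; multiplication by [y0] is
   eventually injective on the annihilators of [I], and an eigenvalue [a] of
   [y / y0] on them forces [y - a y0] into [I].  The eigenvalues of the variables
   are then the coordinates of a common zero of [I]. *)
Lemma graded_nullstellensatz I : homog_ideal I -> no_common_zero I ->
  exists D, forall p, p \is D.-homog -> I p.
Proof.
(* [k] strictly exceeds the codimension of the linear forms in [I], so the case [k = 0] is
   absurd. *)
have [k] : exists k, forall U : {vspace V 1}, (forall v, v \in U <-> I (val v)) ->
    (\dim {:V 1} < \dim U + k)%N.
  by exists (\dim {:V 1}).+1 => U _; lia.
elim: k I => [|k IH] I dI hI zI.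
  have [U HU] := ideal_graded_piece 1 hI.
  by have := dI U HU; have := dimvS (subvf U); lia.
apply: NNPP => noD.
have [y0 Iy0] : exists y0 : V 1, ~ I (val y0).
  apply: NNPP => H; apply: noD; exists 1%N => p hp.
  by apply: NNPP => Ip; apply: H; exists (DHomog hp).
(* Adding a linear form outside [I] enlarges its space of linear forms, so the induction hypothesis
   applies to the new ideal. *)
have IHl (l : V 1) : ~ I (val l) -> exists D, forall p, p \is D.-homog -> ideal_add I (val l) p.
  move=> Il; have hIl := homog_ideal_add hI (dhomog_is_dhomog l).
  apply: IH => // [U HU|x Hx]; last first.
    by apply: zI => p Ip; apply: Hx; apply: sub_ideal_add.
  have [U0 HU0] := ideal_graded_piece 1 hI.
  have := dI U0 HU0; suff : (\dim U0 < \dim U)%N by lia.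
  have sub : (U0 <= U)%VS.
    by apply/subvP => v /HU0 Iv; apply/HU; apply: sub_ideal_add.
  rewrite ltn_neqAle dimvS // andbT; apply/negP => /eqP e.
  apply: Il; apply/HU0.
  have/eqP -> : U0 == U by rewrite eqEdim sub e leqnn.
  by apply/HU; apply: mem_ideal_add.
pose K j := proj1_sig (constructive_indefinite_description _ (annihilator_piece I j)).
have KP j phi : phi \in K j <-> (forall p : V j, I (val p) -> phi p = 0).
  exact: (proj2_sig (constructive_indefinite_description _ (annihilator_piece I j))).
have K0 j : (0 < \dim (K j))%N.
  rewrite lt0n dimv_eq0; apply/negP => /eqP Kj0.
  have [U HU] := ideal_graded_piece j hI.
  apply: noD; exists j => p hp; apply: NNPP => Ip.
  have pU : DHomog hp \notin U by apply/negP => /HU.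
  have [phi phip phiU] := separating_functional pU.
  have : phi \in K j by apply/KP => q /HU /phiU.
  by rewrite Kj0 memv0 => /eqP phi0; move: phip; rewrite phi0 zero_lfunE eqxx.
have mulK (y : V 1) j : (linfun (@dual_mul _ _ y j) @: K j.+1 <= K j)%VS.
  apply/subvP => _ /memv_imgP[phi /KP phiK ->]; apply/KP => p Ip.
  by rewrite lfunE /= dual_mulE phiK //=; apply: idealM.
have line (y : V 1) : exists a, I (val y - a *: val y0).
  have [D0 HD0] := IHl y0 Iy0.
  have [||a [D' Ha]] := @tower_eigenvector F (fun j => 'Hom(V j, F^o))
    (fun j => linfun (@dual_mul _ _ y0 j)) (fun j => linfun (@dual_mul _ _ y j))
    K D0 K0 (mulK y0) (mulK y).
  - move=> j phi; rewrite !lfunE /=; apply/lfunP => p; rewrite !dual_mulE.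
    by congr (phi _); apply: val_inj; rewrite /= mulrCA.
  - move=> j phi D0j /KP phiK; rewrite lfunE /= => phi0.
    apply: (annihilator_ideal_add hI phiK phi0).
    by apply: (ideal_homog_mono (homog_ideal_add hI (dhomog_is_dhomog y0)) _ HD0); lia.
  (* If [y - a y0] were outside [I], its transposed multiplication would be injective on the
     annihilators of high degree, and the eigenvector is in its kernel. *)
  exists a; apply: NNPP => Il.
  have {Il} Il : ~ I (val (y - a *: y0)) by [].
  have [D1 HD1] := IHl _ Il.
  have [phi [/KP phiK /eqP phi0 phil]] := Ha (maxn D' D1) (leq_maxl _ _).
  apply: phi0; apply: (annihilator_ideal_add hI phiK (l := y - a *: y0)).
    apply/lfunP => p; rewrite dual_mul_line zero_lfunE.
    have {phil} -> : dual_mul y phi = a *: dual_mul y0 phi.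
      by move: phil; do 2 rewrite lfunE /=.
    by rewrite scale_lfunE /= subrr.
  by apply: (ideal_homog_mono (homog_ideal_add hI (dhomog_is_dhomog _)) _ HD1); lia.
have [a Ia] : exists a : 'I_n.+1 -> F, forall i, I ('X_i - a i *: val y0).
  apply: (fin_all_exists (P := fun i c => I ('X_i - c *: val y0))) => i.
  have hX : ('X_i : {mpoly F[n.+1]}) \is 1.-homog by rewrite dhomogX; apply/eqP; rewrite /= mdeg1.
  exact: (line (DHomog hX)).
(* [y0] is congruent to [y0(a) y0] modulo [I] and lies outside [I]. *)
have ya : (val y0).@[a] = 1.
  have := ideal_eval_congr hI Ia (dhomog_is_dhomog y0).
  rewrite expr1 -{1}[val y0]scale1r -scalerBl => Ic.
  apply/eqP; rewrite eq_sym -subr_eq0; apply/negPn/negP => c0; apply: Iy0.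
  by rewrite -[val y0](scalerK c0); apply: idealZ.
(* Since [y0(a) = 1], the point [a] is not the origin, hence not a common zero of [I]. *)
have [s [Is sa]] : exists s, I s /\ s.@[a] != 0.
  apply: NNPP => H.
  have a0 : forall i, a i = 0.
    apply: zI => p Ip; apply/eqP; apply/negPn/negP => pa.
    by apply: H; exists p.
  have := @homog_meval_scale _ _ _ _ 0 a (dhomog_is_dhomog y0).
  rewrite expr1 mul0r (meval_eq (v2 := a)) ?ya => [/eqP|i]; first by rewrite oner_eq0.
  by rewrite mul0r a0.
have [d sda] : exists d, (pihomog mdeg d s).@[a] != 0.
  apply: NNPP => H; case/eqP: sa.
  rewrite (@pihomog_partitionE _ _ mdeg _ s (leqnn _)) linear_sum /= big1 // => d _.
  by apply/eqP/negPn/negP => ne; apply: H; exists (nat_of_ord d).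
apply: noD; exists d => p hp.
(* The component [s_d] lies in [I] and is congruent to [s_d(a) y0^d], so [y0^d] is in [I]; every
   form of degree [d] is a multiple of [y0^d] modulo [I]. *)
have yd : I (val y0 ^+ d).
  have Isd := ideal_pihomog hI d Is.
  have := ideal_eval_congr hI Ia (pihomogP mdeg d s).
  move=> /(idealB hI Isd); rewrite opprB addrC subrK => /(idealZ hI (pihomog mdeg d s).@[a]^-1).
  by rewrite scalerA mulVf // scale1r.
have := ideal_eval_congr hI Ia hp.
by move=> /(idealD hI)/(_ (idealZ hI p.@[a] yd)); rewrite subrK.
Qed.

End Nullstellensatz.

(** * Forms vanishing together only at the origin: counting monomials *)

Lemma card_independent_le (F : fieldType) (W : lmodType F) (G T : finType)
    (v : G -> W) (w : T -> W) :
    (forall g, exists c : T -> F, v g = \sum_t c t *: w t) ->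
    (forall u : G -> F, \sum_g u g *: v g = 0 -> forall g, u g = 0) ->
  (#|G| <= #|T|)%N.
Proof.
move=> /fin_all_exists[C vE] indep; rewrite leqNgt; apply/negP => lt.
pose M := \matrix_(i < #|G|, j < #|T|) C (enum_val i) (enum_val j).
(* More vectors than generators would give the coefficient matrix a nonzero left kernel, hence a
   linear relation. *)
have [] : exists2 r : 'rV_#|G|, r *m M = 0 & r != 0.
  have /rowV0Pn[r /sub_kermxP rM r0] : kermx M != 0.
    by rewrite -mxrank_eq0 mxrank_ker; have := rank_leq_col M; lia.
  by exists r.
move=> r rM /eqP r0; apply: r0; apply/rowP => l; rewrite mxE.
rewrite -[l]enum_valK; apply: (indep (fun g => r 0 (enum_rank g))).
under eq_bigr => g _ do rewrite vE scaler_sumr.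
rewrite exchange_big big1 //= => t _.
under eq_bigr => g _ do rewrite scalerA.
rewrite -scaler_suml.
have -> : \sum_g r 0 (enum_rank g) * C g t = (r *m M) 0 (enum_rank t).
  rewrite mxE [RHS](reindex_onto enum_rank enum_val) => [|j _]; last exact: enum_valK.
  by apply: eq_big => [g|g _]; rewrite ?enum_rankK ?eqxx // mxE !enum_rankK.
by rewrite rM mxE scale0r.
Qed.

Section Forms.
Variables (F : fieldType) (a k e : nat) (h : 'I_k -> {mpoly F[a]}).
Hypothesis he : forall j, h j \is e.-homog.

Definition gen_ideal (p : {mpoly F[a]}) :=
  exists c : 'I_k -> {mpoly F[a]}, p = \sum_j c j * h j.

Lemma pihomog_gen d (c : 'I_k -> {mpoly F[a]}) :
  pihomog mdeg d (\sum_j c j * h j) =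
  \sum_j (if (e <= d)%N then pihomog mdeg (d - e) (c j) else 0) * h j.
Proof.
rewrite linear_sum; apply: eq_bigr => j _ /=; rewrite mulrC.
case: leqP => [ed|de].
  by rewrite -{1}(subnKC ed) pihomog_mulr_homog // mulrC.
by rewrite mul0r (pihomog_mulr_homog_lt _ (he j)).
Qed.

Lemma homog_gen_ideal : homog_ideal gen_ideal.
Proof.
split.
- by exists (fun=> 0); rewrite big1 // => j _; rewrite mul0r.
- move=> _ _ [c ->] [c' ->]; exists (fun j => c j + c' j).
  by rewrite -big_split; apply: eq_bigr => j _ /=; rewrite mulrDl.
- move=> _ q [c ->]; exists (fun j => q * c j).
  by rewrite mulr_sumr; apply: eq_bigr => j _; rewrite mulrA.
- by move=> d _ [c ->]; rewrite pihomog_gen; eexists.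
Qed.

Definition lin_closed (P : {mpoly F[a]} -> Prop) :=
  P 0 /\ forall c p q, P p -> P q -> P (c *: p + q).

(* Impredicative encoding of the linear span of the products [x^b * h^al], which
   makes its closure properties immediate. *)
Definition mixed_span D N (p : {mpoly F[a]}) :=
  forall P, lin_closed P ->
    (forall (b : 'X_{1..a}) (al : 'I_k -> nat), (forall i, b i <= D)%N ->
       (forall j, al j <= N)%N -> P ('X_[b] * \prod_j h j ^+ al j)) -> P p.

Lemma lin_closed_sum P (T : Type) (r : seq T) (Q : pred T) (G : T -> {mpoly F[a]}) :
  lin_closed P -> (forall i, Q i -> P (G i)) -> P (\sum_(i <- r | Q i) G i).
Proof.
move=> [P0 PD] H; elim/big_rec : _ => // i p Qi Pp.
by rewrite -[G i]scale1r; apply: PD => //; apply: H.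
Qed.

Lemma lin_closed_scale P c p : lin_closed P -> P p -> P (c *: p).
Proof. by move=> [P0 PD] Pp; rewrite -[c *: p]addr0; apply: PD. Qed.

Lemma mixed_span_mono D N N' p : (N <= N')%N -> mixed_span D N p -> mixed_span D N' p.
Proof.
move=> NN H P lP HP; apply: H => // b al bD alN.
by apply: HP => // j; apply: leq_trans (alN j) NN.
Qed.

Lemma mixed_span_mul D N p j : mixed_span D N p -> mixed_span D N.+1 (p * h j).
Proof.
move=> H P lP HP; apply: (H (fun q => P (q * h j))).
  case: lP => P0 PD; split=> [|c q q' Pq Pq']; first by rewrite mul0r.
  by rewrite mulrDl -scalerAl; apply: PD.
move=> b al bD alN.
have -> : 'X_[b] * \prod_i h i ^+ al i * h j =
    'X_[b] * \prod_i h i ^+ (al i + (i == j))%N.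
  rewrite -mulrA; congr (_ * _); rewrite [LHS]mulrC (bigD1 j) //= [RHS](bigD1 j) //=.
  rewrite eqxx addn1 exprS mulrA; congr (_ * _).
  by apply: eq_bigr => i /negbTE->; rewrite addn0.
apply: HP => // i; have := alN i; case: (i == j); lia.
Qed.

(** Strong induction on the degree: above [D], [p] is a combination of the [h j] with coefficients
    of degree [N - e], which is smaller as [e > 0]. *)
Lemma homog_mixed_span D N p : (0 < e)%N ->
    (forall p, p \is D.+1.-homog -> gen_ideal p) ->
  p \is N.-homog -> mixed_span D N p.
Proof.
move=> e0 HD; elim/ltn_ind: N p => N IH p hp P lP HP.
case: (leqP N D) => ND.
  rewrite [p]mpolyE big_seq; apply: lin_closed_sum => // m /(dhomog_mf hp) /= hm.
  apply: lin_closed_scale => //.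
  have := HP m (fun=> 0%N); rewrite big1 ?mulr1 => [|j _]; last by rewrite expr0.
  apply=> // i; apply: leq_trans ND; have := hm; rewrite mdegE (bigD1 i) //=; lia.
have [c pc] := ideal_homog_mono homog_gen_ideal ND HD hp.
have := pihomog_gen N c; rewrite -pc (pihomog_dE hp) => ->.
apply: lin_closed_sum => // j _; case: leqP => [eN|_]; last by rewrite mul0r; case: lP.
suff : mixed_span D N (pihomog mdeg (N - e) (c j) * h j) by apply.
apply: (@mixed_span_mono _ (N - e).+1); first by lia.
apply: mixed_span_mul; apply: IH; [lia | exact: pihomogP].
Qed.

(** The [q ^ a] monomials with exponents below [q] are independent, of degree at most [a * q]; they
    lie in the span of the products counted on the right. *)
Lemma mixed_span_growth D q : (0 < e)%N ->
    (forall p, p \is D.+1.-homog -> gen_ideal p) ->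
  (q ^ a <= D.+1 ^ a * (a * q).+1 ^ k)%N.
Proof.
move=> e0 HD; set N := (a * q)%N.
pose mon (b : 'I_a -> nat) : 'X_{1..a} := [multinom b i | i < a].
pose w (t : {ffun 'I_a -> 'I_D.+1} * {ffun 'I_k -> 'I_N.+1}) : {mpoly F[a]} :=
  'X_[mon (fun i => nat_of_ord (t.1 i))] * \prod_j h j ^+ t.2 j.
have := @card_independent_le F {mpoly F[a]} {ffun 'I_a -> 'I_q} _
  (fun g => 'X_[mon (fun i => nat_of_ord (g i))]) w.
rewrite card_prod !card_ffun !card_ord; apply.
- move=> g; set v := 'X_[_].
  have gN : (mdeg (mon (fun i => nat_of_ord (g i))) <= N)%N.
    rewrite mdegE (eq_bigr (fun i => nat_of_ord (g i))); last by move=> i _; rewrite mnmE.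
    apply: leq_trans (_ : \sum_(i < a) q <= _)%N; last by rewrite sum_nat_const card_ord.
    by apply: leq_sum => i _; apply: ltnW.
  have hv : v \is (mdeg (mon (fun i => nat_of_ord (g i)))).-homog by rewrite dhomogX.
  apply: (mixed_span_mono gN (homog_mixed_span e0 HD hv)
    (P := fun p => exists c, p = \sum_t c t *: w t)); first split.
  + by exists (fun=> 0); rewrite big1 // => t _; rewrite scale0r.
  + move=> c _ _ [c1 ->] [c2 ->]; exists (fun t => c * c1 t + c2 t).
    rewrite scaler_sumr -big_split; apply: eq_bigr => t _ /=.
    by rewrite scalerDl scalerA.
  + move=> b al bD alN.
    pose t : {ffun 'I_a -> 'I_D.+1} * {ffun 'I_k -> 'I_N.+1} :=
      ([ffun i => inord (b i)], [ffun j => inord (al j)]).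
    exists (fun s => (s == t)%:R).
    rewrite (bigD1 t) //= eqxx scale1r.
    rewrite [X in _ + X]big1; last by move=> s st; rewrite (negbTE st) scale0r.
    rewrite addr0; congr ('X_[_] * _).
      by apply/mnmP => i; rewrite mnmE ffunE inordK // ltnS.
    by apply: eq_bigr => j _; rewrite ffunE inordK // ltnS.
- move=> u /mpolyP Hu g; have := Hu (mon (fun i => nat_of_ord (g i))).
  rewrite mcoeff0 raddf_sum /= (bigD1 g) //= mcoeffZ mcoeffX eqxx mulr1.
  rewrite big1 ?addr0 // => g' g'g; rewrite mcoeffZ mcoeffX.
  case: eqP => [/mnmP eq|]; last by rewrite mulr0.
  case/eqP: g'g; apply/ffunP => i; apply: val_inj.
  by have := eq i; rewrite !mnmE.
Qed.

End Forms.

Theorem forms_no_common_zero_le (F : numClosedFieldType) (a k e : nat)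
    (h : 'I_k -> {mpoly F[a]}) :
    (0 < e)%N -> (forall j, h j \is e.-homog) ->
    (forall x, (forall j, (h j).@[x] = 0) -> forall i, x i = 0) ->
  (a <= k)%N.
Proof.
case: a h => [//|n] h e0 he hz.
have hI := homog_gen_ideal he.
have [|D HD] := graded_nullstellensatz hI.
  move=> x Hx; apply: hz => j; apply: Hx.
  exists (fun i => (i == j)%:R); rewrite (bigD1 j) //= eqxx mul1r.
  by rewrite big1 ?addr0 // => i /negbTE->; rewrite mul0r.
have {}HD := ideal_homog_mono hI (leqnSn D) HD.
rewrite leqNgt; apply/negP => kn.
(* For [q = B.+1] one has [n.+1 * q + 1 <= n.+2 * q], so the right side of the growth estimate is at
   most [B * q ^ k], which is below [q ^ k.+1 <= q ^ n.+1]. *)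
set B := (D.+1 ^ n.+1 * n.+2 ^ k)%N.
have := mixed_span_growth he B.+1 e0 HD; apply/negP; rewrite -ltnNge.
apply: leq_ltn_trans (_ : B * B.+1 ^ k < _)%N.
  rewrite -mulnA leq_mul2l; apply/orP; right.
  case: (k) => [|k']; first by rewrite !expn0.
  by rewrite -expnMn leq_exp2r //; lia.
apply: leq_trans (_ : B.+1 ^ k.+1 <= _)%N; last by rewrite leq_pexp2l.
by rewrite expnS ltn_mul2r ltnSn expn_gt0.
Qed.

(** * The chain rule for polynomials *)

Section ChainRule.
Variables (R : comNzRingType) (n k : nat).

Lemma mderiv_comp_mpoly (lq : n.-tuple {mpoly R[k]}) (p : {mpoly R[n]}) (j : 'I_k) :
  (p \mPo lq)^`M(j) = \sum_i (p^`M(i) \mPo lq) * (tnth lq i)^`M(j).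
Proof.
(* The identity is stable under sums and products, so constants and variables suffice. *)
pose Q (p : {mpoly R[n]}) :=
  (p \mPo lq)^`M(j) = \sum_i (p^`M(i) \mPo lq) * (tnth lq i)^`M(j).
have QM p1 p2 : Q p1 -> Q p2 -> Q (p1 * p2).
  rewrite /Q => Q1 Q2; rewrite rmorphM mderivM Q1 Q2 mulr_suml mulr_sumr -big_split.
  apply: eq_bigr => i _ /=; rewrite mderivM linearD /= !rmorphM /=; ring.
have QC c : Q c%:MP.
  rewrite /Q comp_mpolyC mderivC big1 // => i _.
  by rewrite mderivC comp_mpoly0 mul0r.
have Q1 : Q 1 by rewrite -mpolyC1; apply: QC.
have QX i : Q 'X_i.
  rewrite /Q comp_mpolyXU (bigD1 i) //= big1 => [|i' i'i].
    rewrite mderivX mnm1E eqxx scale1r.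
    have -> : (U_(i) - U_(i))%MM = 0%MM by apply/mnmP => l; rewrite mnmBE mnm0E subnn.
    by rewrite mpolyX0 comp_mpoly1 mul1r addr0 -tnth_nth.
  by rewrite mderivX mnm1E eq_sym (negbTE i'i) scale0r comp_mpoly0 mul0r.
have QXm m : Q 'X_[m].
  rewrite mpolyXE_id; elim/big_ind : _ => // i _.
  by elim: (m i) => [|l IH]; rewrite ?expr0 // exprS; apply: QM.
rewrite -/(Q p) [p]mpolyE; elim/big_rec : _ => [|m q _ Qq].
  by rewrite -[0]mpolyC0; apply: QC.
have := QM _ _ (QC p@_m) (QXm m); rewrite mul_mpolyC => Qm.
rewrite /Q linearD /= mderivD Qm Qq -big_split; apply: eq_bigr => i _ /=.
by rewrite mderivD linearD /= mulrDl.
Qed.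

Lemma mderiv_homog d (p : {mpoly R[n]}) i :
  p \is d.-homog -> p^`M(i) \is d.-1.-homog.
Proof.
move=> /dhomogP hp; apply/dhomogP => m.
rewrite mcoeff_msupp mcoeff_deriv => ne.
have : (m + U_(i))%MM \in msupp p.
  by rewrite mcoeff_msupp; apply: contra ne => /eqP->; rewrite mul0rn.
by move=> /hp /=; rewrite mdegD mdeg1 addn1 => <-.
Qed.

Lemma comp_mpoly_homog d (lq : n.-tuple {mpoly R[k]}) (p : {mpoly R[n]}) :
  (forall i, tnth lq i \is 1.-homog) -> p \is d.-homog -> p \mPo lq \is d.-homog.
Proof.
move=> hq /dhomogP hp; rewrite comp_mpolyE big_seq.
apply: rpred_sum => m /hp /= <-; apply: rpredZ; rewrite mdegE.
elim/big_ind2 : _ => [|p1 d1 p2 d2 h1 h2|i _]; first exact: dhomog1.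
  exact: dhomogM.
by have := dhomogMn (m i) (hq i); rewrite mul1n.
Qed.

End ChainRule.

(** * The gradient and the eigenspaces of stabilizer elements *)

Section LinearStabilizer.
Variables (C : numClosedFieldType) (n e : nat).
Local Notation m := n.+1.
Variable f : {mpoly C[m]}.
Hypothesis hf : f \is e.+1.-homog.
Hypothesis hsmooth : forall x : 'I_m -> C,
  (forall i, (f^`M(i)).@[x] = 0) -> forall j, x j = 0.

Definition linear_subst (A : 'M[C]_m) : m.-tuple {mpoly C[m]} :=
  [tuple \sum_(j < m) A i j *: 'X_j | i < m].

Definition stab (A : 'M[C]_m) := A \in unitmx /\ f \mPo linear_subst A = f.

(** A row vector, since the gradient is a covector: matrices act on it from the right. *)
Definition grad (x : 'cV[C]_m) : 'rV[C]_m := \row_i (f^`M(i)).@[fun j => x j 0].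

Lemma grad_eq0 x : grad x = 0 -> x = 0.
Proof.
move=> g0; apply/colP => j; rewrite mxE.
by apply: (hsmooth (x := fun j => x j 0)) => i; move/rowP/(_ i): g0; rewrite !mxE.
Qed.

Lemma grad_scale c x : grad (c *: x) = c ^+ e *: grad x.
Proof.
apply/rowP => i; rewrite !mxE -(homog_meval_scale c _ (mderiv_homog i hf)).
by apply: meval_eq => j; rewrite mxE.
Qed.

Lemma linear_subst_meval A (x : 'cV[C]_m) i :
  (tnth (linear_subst A) i).@[fun j => x j 0] = (A *m x) i 0.
Proof.
rewrite tnth_mktuple raddf_sum mxE; apply: eq_bigr => j _ /=.
by rewrite mevalZ mevalXU.
Qed.

(** Differentiate [f(A x) = f(x)]. *)
Lemma grad_stab A x : stab A -> grad (A *m x) *m A = grad x.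
Proof.
case=> _ fA; apply/rowP => j; rewrite !mxE -fA mderiv_comp_mpoly.
rewrite raddf_sum; apply: eq_bigr => i _ /=; rewrite mxE mevalM; congr (_ * _).
  by rewrite comp_mpoly_meval; apply: meval_eq => l; rewrite linear_subst_meval.
rewrite tnth_mktuple (raddf_sum (mderiv j)) raddf_sum (bigD1 j) //= big1 => [|l lj].
  rewrite mderivZ mderivX mnm1E eqxx scale1r mevalZ.
  have -> : (U_(j) - U_(j))%MM = 0%MM by apply/mnmP => l; rewrite mnmBE mnm0E subnn.
  by rewrite mpolyX0 meval1 mulr1 addr0.
by rewrite mderivZ mderivX mnm1E (negbTE lj) scale0r scaler0 meval0.
Qed.

Lemma linear_subst_mul (p : {mpoly C[m]}) A B : p \mPo linear_subst (A *m B) =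
   (p \mPo linear_subst A) \mPo linear_subst B.
Proof.
elim/mpolyind: p => [|c mm p _ _ IH]; first by rewrite !comp_mpoly0.
rewrite !comp_mpolyD IH; congr (_ + _); rewrite !comp_mpolyZ; congr (_ *: _).
rewrite !comp_mpolyX rmorph_prod; apply: eq_bigr => i _; rewrite rmorphXn /=.
congr (_ ^+ _); rewrite !tnth_mktuple linear_sum /=.
under [RHS]eq_bigr => l _ do rewrite comp_mpolyZ comp_mpolyXU -tnth_nth tnth_mktuple scaler_sumr.
rewrite exchange_big; apply: eq_bigr => j _ /=; rewrite mxE scaler_suml.
by apply: eq_bigr => l _; rewrite scalerA.
Qed.

Lemma linear_subst1 (p : {mpoly C[m]}) : p \mPo linear_subst 1%:M = p.
Proof.
rewrite -[RHS]comp_mpoly_id; congr (_ \mPo _); apply: eq_from_tnth => i.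
rewrite !tnth_mktuple (bigD1 i) //= big1 => [|j ji].
  by rewrite mxE eqxx scale1r addr0.
by rewrite mxE eq_sym (negbTE ji) scale0r.
Qed.

Lemma stabM A B : stab A -> stab B -> stab (A *m B).
Proof.
move=> [uA fA] [uB fB]; split; first by rewrite unitmx_mul uA.
by rewrite linear_subst_mul fA.
Qed.

Lemma stab1 : stab 1%:M.
Proof. by split; [exact: unitmx1 | exact: linear_subst1]. Qed.

Lemma stabV A : stab A -> stab (invmx A).
Proof.
move=> [uA fA]; split; first by rewrite unitmx_inv.
by rewrite -{1}fA -linear_subst_mul mulmxV // linear_subst1.
Qed.

Lemma stabX A k : stab A -> stab (A ^+ k).
Proof.
by move=> sA; elim: k => [|k IH]; [exact: stab1 | rewrite exprS; exact: stabM].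
Qed.

(** [eigenspace] consists of row eigenvectors; the column eigenvectors of [A] are the row
    eigenvectors of [A^T]. *)
Lemma rank_eigenspace_tr (A : 'M[C]_m) z :
  \rank (eigenspace A^T z) = \rank (eigenspace A z).
Proof.
rewrite /eigenspace !mxrank_ker; congr (_ - _)%N.
by rewrite -[RHS]mxrank_tr linearB /= tr_scalar_mx.
Qed.

Lemma stab_eigen_neq0 A z : stab A -> (0 < \rank (eigenspace A z))%N -> z != 0.
Proof.
move=> [uA _]; rewrite lt0n mxrank_eq0; apply: contra => /eqP->.
rewrite /eigenspace raddf0 subr0 -mxrank_eq0 mxrank_ker mxrank_unit //.
by rewrite subnn.
Qed.

(** By homogeneity the invariance reads [z^e grad(x) A = grad(x)]. *)
Lemma grad_eigen A z (x : 'cV[C]_m) : stab A -> z != 0 -> A *m x = z *: x ->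
  (grad x <= eigenspace A (z^-1 ^+ e))%MS.
Proof.
move=> sA z0 Ax; apply/eigenspaceP.
rewrite -[in RHS](grad_stab x sA) Ax grad_scale -scalemxAl scalerA.
by rewrite -exprMn mulVf // expr1n scale1r.
Qed.

(* The gradient maps the [z]-eigenspace to the dual of the [z^-e]-eigenspace
   and vanishes only at the origin. *)
Lemma rank_eigenspace_le A z : (0 < e)%N -> stab A ->
  (\rank (eigenspace A z) <= \rank (eigenspace A (z^-1 ^+ e)))%N.
Proof.
move=> e0 sA; case: (posnP (\rank (eigenspace A z))) => [->//|rz].
have z0 := stab_eigen_neq0 sA rz.
rewrite -rank_eigenspace_tr.
set E := eigenspace A^T z; set E' := eigenspace A _.
pose B := row_base E; pose W := row_base E'.
pose sB : m.-tuple {mpoly C[\rank E]} := [tuple \sum_k B k i *: 'X_k | i < m].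
(* In coordinates on [E] and [E'] the gradient becomes [\rank E'] forms of degree [e] in [\rank E]
   variables, with only the trivial common zero. *)
pose h (j : 'I_(\rank E')) := \sum_i pinvmx W i j *: (f^`M(i) \mPo sB).
have sBE (y : 'I_(\rank E) -> C) i :
    (tnth sB i).@[y] = ((\row_k y k) *m B)^T i 0.
  rewrite tnth_mktuple raddf_sum !mxE; apply: eq_bigr => k _ /=.
  by rewrite mevalZ mevalXU mxE mulrC.
have hE y j : (h j).@[y] = (grad ((\row_k y k) *m B)^T *m pinvmx W) 0 j.
  rewrite /h raddf_sum mxE; apply: eq_bigr => i _ /=.
  rewrite mevalZ mxE mulrC comp_mpoly_meval; congr (_ * _).
  by rewrite [RHS]mxE; apply: meval_eq => l; rewrite sBE.
apply: (@forms_no_common_zero_le C _ _ e h e0) => [j|y hy].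
  apply: rpred_sum => i _; apply: rpredZ.
  apply: comp_mpoly_homog (mderiv_homog i hf) => i'.
  rewrite tnth_mktuple; apply: rpred_sum => l _; apply: rpredZ.
  by rewrite dhomogX /= mdeg1.
set x := ((\row_k y k) *m B)^T in hE.
have Ax : A *m x = z *: x.
  apply: trmx_inj; rewrite trmx_mul linearZ /= trmxK; apply/eigenspaceP.
  by rewrite (submx_trans (submxMl _ _)) // eq_row_base.
have : grad x = 0.
  rewrite -(mulmxKpV (A := grad x) (B := W)) ?eq_row_base ?grad_eigen //.
  suff -> : grad x *m pinvmx W = 0 by rewrite mul0mx.
  by apply/rowP => j; rewrite -hE hy mxE.
move/grad_eq0/(congr1 trmx); rewrite trmxK trmx0 => yB i.
have : (\row_k y k) = 0.
  by apply: (row_free_inj (row_base_free E)); rewrite yB mul0mx.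
by move/rowP/(_ i); rewrite !mxE.
Qed.

End LinearStabilizer.

(** * Leading coefficients and binomial polynomials *)

Section PolynomialFacts.
Variable C : numFieldType.

Lemma poly_eq_on_nat (p q : {poly C}) :
  (forall s : nat, p.[s%:R] = q.[s%:R]) -> p = q.
Proof.
move=> H; apply/eqP; rewrite -subr_eq0; apply/negPn/negP => pq0.
have := max_poly_roots (rs := [seq s%:R | s <- iota 0 (size (p - q))]) pq0.
rewrite size_map size_iota ltnn => H'; suff : false by []; apply: H'.
  by apply/allP => _ /mapP[s _ ->]; rewrite rootE hornerD hornerN H subrr.
by rewrite map_inj_uniq ?iota_uniq // => i j /eqP; rewrite eqr_nat => /eqP.
Qed.

Lemma coefM_top (p q : {poly C}) a b : (size p <= a.+1)%N -> (size q <= b.+1)%N ->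
  (size (p * q)%R <= (a + b).+1)%N /\ (p * q)`_(a + b)%N = p`_a * q`_b.
Proof.
move=> pa qb; split.
  by apply: leq_trans (size_polyMleq _ _) _; lia.
rewrite coefM.
have alt : (a < (a + b).+1)%N by lia.
rewrite (bigD1 (Ordinal alt)) //= addKn big1 ?addr0 // => i ia.
case: (ltngtP i a) => [lt|gt|eq].
- by rewrite [X in _ * X]nth_default ?mulr0 //; apply: (leq_trans qb); lia.
- by rewrite nth_default ?mul0r //; apply: (leq_trans pa); lia.
- by case/eqP: ia; apply: val_inj.
Qed.

Lemma coefX_top (p : {poly C}) a k : (size p <= a.+1)%N ->
  (size (p ^+ k) <= (a * k).+1)%N /\ (p ^+ k)`_(a * k)%N = p`_a ^+ k.
Proof.
move=> pa; elim: k => [|k [IH1 IH2]].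
  by rewrite muln0 !expr0 coef1 size_poly1.
rewrite mulnS !exprS; have [H1 H2] := coefM_top pa IH1.
by rewrite H1 H2 IH2.
Qed.

(** [mmap polyC P p] is [p] evaluated at the polynomials [P i]; only their coefficients of degree
    [r] reach degree [r * e]. *)
Lemma mmap_coef_top n e (p : {mpoly C[n]}) (P : 'I_n -> {poly C}) r :
  p \is e.-homog -> (forall i, (size (P i) <= r.+1)%N) ->
  (mmap polyC P p)`_(r * e)%N = p.@[fun i => (P i)`_r].
Proof.
move=> /dhomogP hp hP; rewrite mevalE /mmap coef_sum big_seq [RHS]big_seq.
apply: eq_bigr => mm /hp /= hm; rewrite coefCM; congr (_ * _).
have H (s : seq 'I_n) : (size (\prod_(i <- s) P i ^+ mm i)%R <= (r * \sum_(i <- s) mm i).+1)%N /\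
    (\prod_(i <- s) P i ^+ mm i)`_(r * \sum_(i <- s) mm i)%N = \prod_(i <- s) (P i)`_r ^+ mm i.
  elim: s => [|i s [IH1 IH2]]; first by rewrite !big_nil muln0 size_poly1 coef1.
  have [X1 X2] := coefX_top (mm i) (hP i).
  by rewrite !big_cons mulnDr; have [-> ->] := coefM_top X1 IH1; rewrite X2 IH2.
by rewrite -hm mdegE; case: (H (index_enum 'I_n)).
Qed.

(** The polynomial whose value at a natural number [s] is ['C(s, j)]. *)
Definition binpoly j : {poly C} := (j`!%:R)^-1 *: \prod_(i < j) ('X - (i%:R)%:P).

Lemma size_binpoly j : size (binpoly j) = j.+1.
Proof.
rewrite size_scale ?invr_eq0 ?pnatr_eq0 -?lt0n ?fact_gt0 //.
by rewrite size_prod_XsubC /index_enum -enumT size_enum_ord.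
Qed.

Lemma coef_binpoly j : (binpoly j)`_j = (j`!%:R)^-1.
Proof.
have := monic_prod_XsubC (index_enum 'I_j) xpredT (fun i : 'I_j => i%:R : C).
rewrite coefZ monicE lead_coefE size_prod_XsubC /index_enum -enumT size_enum_ord /=.
by move=> /eqP ->; rewrite mulr1.
Qed.

Lemma horner_binpoly j s : (binpoly j).[s%:R] = 'C(s, j)%:R.
Proof.
rewrite hornerZ horner_prod.
have -> : \prod_(i < j) ('X - (i%:R)%:P).[s%:R] = (s ^_ j)%:R :> C.
  elim: j => [|j IH]; first by rewrite big_ord0 ffactn0.
  rewrite big_ord_recr /= IH ffactnSr natrM !hornerE.
  case: (leqP j s) => sj; first by rewrite natrB.
  by rewrite ffact_small // !mul0r.
rewrite -bin_ffact natrM mulrC mulfK //.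
by rewrite pnatr_eq0 -lt0n fact_gt0.
Qed.

Lemma sum_binpoly (a : nat -> C) r :
  (size (\sum_(j < r.+1) a j *: binpoly j)%R <= r.+1)%N /\
  (\sum_(j < r.+1) a j *: binpoly j)`_r = a r * (r`!%:R)^-1.
Proof.
split.
  apply: leq_trans (size_sum _ _ _) _; apply/bigmax_leqP => j _.
  by apply: leq_trans (size_scale_leq _ _) _; rewrite size_binpoly ltnS -ltnS.
rewrite big_ord_recr /= coefD coefZ coef_binpoly coef_sum big1 ?add0r // => j _.
by rewrite coefZ nth_default ?mulr0 // size_binpoly.
Qed.

End PolynomialFacts.

(** * Unipotent elements and the exponent of the stabilizer *)

Lemma unipotentX (R : comNzRingType) n (u : 'M[R]_n.+1) r s : (u - 1) ^+ r.+1 = 0 ->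
  u ^+ s = \sum_(j < r.+1) (u - 1) ^+ j *+ 'C(s, j).
Proof.
move=> Nr; have -> : u = 1 + (u - 1) by rewrite addrC subrK.
set N := u - 1 in Nr *; have -> : 1 + N - 1 = N by rewrite addrC addKr.
rewrite exprDn_comm; last exact: commr_sym (commr1 _).
(* Nilpotency removes the terms of the binomial expansion beyond [r] when [s > r]; when [s <= r] the
   extra binomial coefficients vanish. *)
have big k : \sum_(j < r.+1 + k) N ^+ j *+ 'C(s, j) = \sum_(j < r.+1) N ^+ j *+ 'C(s, j).
  rewrite big_split_ord /= [X in _ + X]big1 ?addr0 // => i _.
  by rewrite exprD Nr mul0r mul0rn.
under eq_bigr => i _ do rewrite expr1n mul1r.
case: (leqP s r) => sr; last first.
  by have -> : s.+1 = (r.+1 + (s - r))%N by lia; apply: big.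
have -> : r.+1 = (s.+1 + (r - s))%N by lia.
rewrite big_split_ord /= [X in _ = _ + X]big1 ?addr0 // => i _.
by rewrite bin_small ?mulr0n //; lia.
Qed.

(** A common multiple of all differences [E ^ j - E ^ i] with [i < j <= n.+1] and [E = e ^ 2]; the
    order of each eigenvalue divides one of them. *)
Definition stab_exponent n e :=
  (\prod_(j < n.+2) \prod_(i < j) ((e ^ 2) ^ j - (e ^ 2) ^ i))%N.

Lemma stab_exponent_gt0 n e : (1 < e)%N -> (0 < stab_exponent n e)%N.
Proof.
move=> e1; rewrite /stab_exponent prodn_gt0 // => j; rewrite prodn_gt0 // => i.
by rewrite subn_gt0 ltn_exp2l //; nia.
Qed.

Section StabilizerExponent.
Variables (C : numClosedFieldType) (n e : nat).
Local Notation m := n.+1.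
Variable f : {mpoly C[m]}.
Hypothesis hf : f \is e.+1.-homog.
Hypothesis hsmooth : forall x : 'I_m -> C,
  (forall i, (f^`M(i)).@[x] = 0) -> forall j, x j = 0.
Hypothesis e1 : (1 < e)%N.

(* grad f (u^s x) = grad f (x) u^-s is polynomial in s on both sides, of degree
   r * e on the left and at most r on the right. *)
Lemma stab_unipotent u k : stab f u -> (u - 1) ^+ k = 0 -> u = 1.
Proof.
move=> su uk; set N := u - 1 in uk.
have [r [Nr0 Nr]] : exists r, N ^+ r != 0 /\ N ^+ r.+1 = 0.
  elim: k uk => [|k IH] Nk.
    by have := oner_neq0 'M[C]_m; rewrite -(expr0 N) Nk eqxx.
  by have [/IH//|ne] := eqVneq (N ^+ k) 0; exists k.
case: r Nr0 Nr => [|r] Nr0 Nr.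
  by apply/eqP; rewrite -subr_eq0 -/N -[N]expr1 Nr.
exfalso; move/eqP: Nr0; apply.
have uu : u \is a GRing.unit by case: su.
set R := r.+1; pose v := u^-1; pose M := v - 1.
have MN : M = - (v * N) by rewrite /M /N mulrBr mulVr // mulr1 opprB.
have Mr : M ^+ R.+1 = 0.
  rewrite MN exprNn exprMn_comm ?Nr ?mulr0 //.
  apply: commrB; last exact: commr1.
  by rewrite /GRing.comm mulVr // mulrV.
have gs x s : grad f (u ^+ s *m x) = grad f x *m v ^+ s.
  rewrite -[in RHS](grad_stab x (stabX s su)) -mulmxA.
  have -> : u ^+ s *m v ^+ s = 1%:M.
    by rewrite -[LHS]/(u ^+ s * v ^+ s) /v exprVn mulrV // unitrX.
  by rewrite mulmx1.
suff NR (x : 'cV_m) : N ^+ R *m x = 0.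
  apply/matrixP => i j; have := congr1 (fun y : 'cV_m => y i 0) (NR (delta_mx j 0)).
  by rewrite -colE !mxE.
(* [P i] interpolates coordinate [i] of [u^s x]; its coefficient of degree [R] is that coordinate of
   [N^R x / R!]. *)
pose P i := \sum_(j < R.+1) ((N ^+ j *m x) i 0) *: binpoly C j.
have PE i s : (P i).[s%:R] = (u ^+ s *m x) i 0.
  rewrite (unipotentX s Nr) mulmx_suml summxE horner_sum; apply: eq_bigr => j _.
  by rewrite hornerZ horner_binpoly -scaler_nat -scalemxAl [RHS]mxE mulrC.
have [sP cP] := all_and2 (fun i => sum_binpoly (fun j => (N ^+ j *m x) i 0) R).
have key i : mmap polyC P (f^`M(i)) =
    \sum_(j < R.+1) ((grad f x *m M ^+ j) 0 i) *: binpoly C j.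
  apply: poly_eq_on_nat => s.
  have := congr1 (fun y : 'rV_m => y 0 i) (gs x s); rewrite mxE => H.
  have -> : (mmap polyC P f^`M(i)).[s%:R] = (f^`M(i)).@[fun j => (u ^+ s *m x) j 0].
    rewrite /mmap horner_sum mevalE; apply: eq_bigr => mm _.
    rewrite hornerCM horner_prod; congr (_ * _); apply: eq_bigr => j _.
    by rewrite horner_exp PE.
  rewrite H (unipotentX s Mr) mulmx_sumr summxE horner_sum; apply: eq_bigr => j _.
  by rewrite hornerZ horner_binpoly -scaler_nat -scalemxAr [LHS]mxE mulrC.
(* The coefficient of degree [R * e] on the left is the gradient at [N^R x / R!]; it is zero because
   the right side has size at most [R.+1 <= R * e]. *)
have cx : \col_i (P i)`_R = 0.
  apply: (grad_eq0 hsmooth); apply/rowP => i; rewrite !mxE.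
  have := mmap_coef_top (mderiv_homog i hf) sP; rewrite key /= nth_default.
    by move=> H; rewrite [RHS]H; apply: meval_eq => j; rewrite mxE.
  have [sz _] := sum_binpoly (fun j => (grad f x *m M ^+ j) 0 i) R.
  apply: leq_trans sz _; rewrite /R; nia.
apply/colP => i; move/colP/(_ i): cx; rewrite !mxE cP => /eqP.
by rewrite mulf_eq0 invr_eq0 pnatr_eq0 -[_ == 0%N]negbK -lt0n fact_gt0 orbF mxE => /eqP.
Qed.

(** Two applications of the eigenspace inequality make the spectrum stable under [z |-> z^(e^2)]; as
    there are at most [m] eigenvalues, two of the first [m.+1] iterates coincide. *)
Lemma stab_eigenvalue A z : stab f A -> eigenvalue A z -> z ^+ stab_exponent n e = 1.
Proof.
move=> sA eigz; set E := (e ^ 2)%N.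
have rkE y : (0 < \rank (eigenspace A y))%N = eigenvalue A y.
  by rewrite lt0n mxrank_eq0.
have e0 : (0 < e)%N by lia.
have step y : eigenvalue A y -> eigenvalue A (y ^+ E).
  rewrite -!rkE => /leq_trans/(_ (rank_eigenspace_le hf hsmooth y e0 sA)) H.
  have := leq_trans H (rank_eigenspace_le hf hsmooth _ e0 sA).
  by rewrite -exprVn invrK -exprM.
have iter k : eigenvalue A (z ^+ (E ^ k)).
  by elim: k => [|k IH]; rewrite ?expr1 // expnSr exprM; apply: step.
have z0 : z != 0 by apply: (stab_eigen_neq0 sA); rewrite rkE.
have [i [j [ij eqz]]] : exists i j : 'I_m.+1, (i < j)%N /\ z ^+ (E ^ i) = z ^+ (E ^ j).
  have ninj : ~ injective (fun i : 'I_m.+1 => z ^+ (E ^ i)).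
    move=> inj.
    have cp0 : char_poly A != 0 by rewrite monic_neq0 // char_poly_monic.
    have := max_poly_roots (rs := [seq z ^+ (E ^ i) | i : 'I_m.+1 <- enum 'I_m.+1]) cp0.
    rewrite size_map size_enum_ord size_char_poly ltnn map_inj_uniq ?enum_uniq //.
    move=> H; suff : false by []. apply: H => //.
    by apply/allP => _ /mapP[i _ ->]; rewrite -eigenvalue_root_char.
  apply: NNPP => H; apply: ninj => i j eqz; apply: val_inj.
  by case: (ltngtP i j) => // lt; case: H; [exists i, j | exists j, i].
have zji : z ^+ (E ^ j - E ^ i) = 1.
  apply: (mulIf (expf_neq0 (E ^ i) z0)); rewrite -exprD mul1r subnK ?eqz //.
  by apply: leq_pexp2l; rewrite /E; nia.
have /dvdnP[q ->] : (E ^ j - E ^ i %| stab_exponent n e)%N.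
  rewrite /stab_exponent (bigD1 j) //= dvdn_mulr // (bigD1 (Ordinal ij)) //=.
  by rewrite dvdn_mulr.
by rewrite mulnC exprM zji expr1n.
Qed.

(** All eigenvalues are [N]-th roots of unity, so the characteristic polynomial divides
    [('X^N - 1)^m]; by Cayley-Hamilton [A^N] is unipotent, hence trivial. *)
Lemma stab_expX A : stab f A -> A ^+ stab_exponent n e = 1.
Proof.
move=> sA; set N := stab_exponent n e.
apply: (stab_unipotent (k := m) (stabX N sA)).
have [rs Ers] := closed_field_poly_normal (char_poly A).
rewrite (monicP (char_poly_monic A)) scale1r in Ers.
have szr : size rs = m.
  by have := size_char_poly A; rewrite Ers size_prod_XsubC => -[].
have : char_poly A %| ('X^N - 1) ^+ m.
  rewrite Ers -szr; have : all (fun z => root ('X^N - 1) z) rs.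
    apply/allP => z zrs; rewrite rootE !hornerE subr_eq0; apply/eqP.
    apply: (stab_eigenvalue sA); rewrite eigenvalue_root_char Ers.
    by rewrite root_prod_XsubC.
  elim: rs {Ers szr} => [|z rs IH]; first by rewrite big_nil expr0 dvdpp.
  move=> /= /andP[rz /IH H]; rewrite big_cons exprS dvdp_mul //.
  by rewrite dvdp_XsubCl.
case/dvdpP => q Eq; have := congr1 (horner_mx A) Eq.
rewrite rmorphM /= Cayley_Hamilton mulr0 rmorphXn rmorphB /= rmorphXn /=.
by rewrite horner_mx_X rmorph1.
Qed.

End StabilizerExponent.

(** * Diagonalization and finiteness of the stabilizer *)

Lemma finite_of_injection (T : eqType) (K : finType) (P : T -> Prop) (phi : T -> K) :
    (forall x y, P x -> P y -> phi x = phi y -> x = y) ->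
  exists s : seq T, uniq s /\ forall x, x \in s <-> P x.
Proof.
move=> inj.
pose Q k x := P x /\ phi x = k.
(* [g] is the partial inverse of [phi], obtained by classical choice. *)
pose g k : option T := match excluded_middle_informative (exists x, Q k x) with
  | left ex => Some (proj1_sig (constructive_indefinite_description _ ex))
  | right _ => None end.
have gP k x : g k = Some x <-> Q k x.
  rewrite /g; case: excluded_middle_informative => [ex|nex]; last first.
    by split=> // Qx; case: nex; exists x.
  case: constructive_indefinite_description => y [Py yk] /=; split=> [[<-]//|[Px xk]].
  by congr Some; apply: inj => //; rewrite yk xk.
exists (undup (pmap g (enum K))); split; first exact: undup_uniq.
move=> x; rewrite mem_undup mem_pmap; split=> [/mapP[k _ /esym/gP[]//]|Px].
by apply/mapP; exists (phi x); rewrite ?mem_enum //; apply/esym/gP.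
Qed.

Lemma finite_order_diagonalizable (C : closedFieldType) n (A : 'M[C]_n.+1) N :
    (N%:R != 0 :> C) -> A ^+ N = 1 ->
  exists P d, [/\ P \in unitmx, A = invmx P *m diag_mx d *m P &
                  forall i, d 0 i ^+ N = 1].
Proof.
move=> N0 AN; have Ngt0 : (0 < N)%N by case: (N) N0; rewrite ?eqxx.
have [rs Ers] := closed_field_poly_normal ('X^N - 1%:P : {poly C}).
rewrite lead_coefXnsubC // scale1r in Ers.
have urs : uniq rs.
  rewrite -separable_prod_XsubC -Ers separable_poly.unlock.
  (* Bezout relation [X * N X^(N-1) - N (X^N - 1) = N] between [X^N - 1] and its derivative. *)
  apply/Bezout_coprimepP; exists (- (N%:R)%:P, 'X).
  rewrite derivB derivXn derivC subr0 /=.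
  set p := (X in X %= 1).
  have -> : p = (N%:R : C)%:P.
    rewrite /p mulrnAr -exprS prednK // mulNr mulrBr mulr1 -[in X in _ + X]mulr_natl polyC_natr.
    by rewrite opprB subrK.
  by rewrite -size_poly_eq1 size_polyC N0.
have : diagonalizable A.
  apply/diagonalizableP; exists rs => //; rewrite -Ers.
  apply: mxminpoly_min; rewrite rmorphB /= rmorphXn /= horner_mx_X AN.
  by rewrite horner_mx_C subrr.
case=> P uP /diagonalizable_forPex[d /(simmxLR uP) AE].
exists P, d; rewrite AE mxpoly.conjVmx //; split=> // i.
have PA : P *m A *m invmx P = diag_mx d.
  by rewrite AE mxpoly.conjVmx // !mulmxA mulmxV // mul1mx mulmxK.
have : diag_mx d ^+ N = 1.
  rewrite -PA; have -> k : (P *m A *m invmx P) ^+ k = P *m A ^+ k *m invmx P.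
    elim: k => [|k IH]; first by rewrite !expr0 mulmx1 mulmxV.
    rewrite !exprS IH -[LHS]/(_ *m _) !mulmxA mulmxKV //.
  by rewrite AN mulmx1 mulmxV.
have diagX k : (diag_mx d ^+ k) i i = d 0 i ^+ k.
  elim: k => [|k IH]; first by rewrite !expr0 mxE eqxx.
  by rewrite !exprS -[diag_mx d * _]/(diag_mx d *m _) mul_diag_mx mxE IH.
by move=> /(congr1 (fun M : 'M_n.+1 => M i i)); rewrite diagX mxE eqxx.
Qed.

Section StabilizerFinite.
Variables (C : numClosedFieldType) (n e : nat).
Local Notation m := n.+1.
Variable f : {mpoly C[m]}.
Hypothesis hf : f \is e.+1.-homog.
Hypothesis hsmooth : forall x : 'I_m -> C,
  (forall i, (f^`M(i)).@[x] = 0) -> forall j, x j = 0.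
Hypothesis e1 : (1 < e)%N.
Local Notation N := (stab_exponent n e).

Lemma stab_diagonalizable A : stab f A ->
  exists P d, [/\ P \in unitmx, A = invmx P *m diag_mx d *m P &
                  forall i, d 0 i ^+ N = 1].
Proof.
move=> sA; apply: finite_order_diagonalizable (stab_expX hf hsmooth e1 sA).
by rewrite pnatr_eq0 -lt0n stab_exponent_gt0.
Qed.

Lemma trace_conj_diag (P : 'M[C]_m) d :
  P \in unitmx -> \tr (invmx P *m diag_mx d *m P) = \sum_i d 0 i.
Proof. by move=> uP; rewrite mxtrace_mulC mulmxA mulmxV // mul1mx mxtrace_diag. Qed.

(** The eigenvalues have modulus 1 and sum to [m]; equality in the triangle inequality makes them
    all equal, hence equal to 1. *)
Lemma stab_trace_eq1 A : stab f A -> \tr A = m%:R -> A = 1.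
Proof.
move=> sA; have [P [d [uP -> dN]]] := stab_diagonalizable sA.
rewrite trace_conj_diag // => trd.
have nd i : `|d 0 i| = 1.
  apply/eqP; rewrite -(@pexpr_eq1 _ _ N) ?stab_exponent_gt0 //.
  by rewrite -normrX dN normr1.
have sumnd : \sum_(i < m) `|d 0 i| = m%:R.
  by under eq_bigr => i _ do rewrite nd; rewrite sumr_const card_ord.
have [t _ dt] : {t : C | `|t| == 1 & forall i : 'I_m, true -> d 0 i = t}.
  by apply: normC_sum_eq1 => [|i _]; [rewrite trd sumnd normr_nat | exact: nd].
have t1 : t = 1.
  move: trd; under eq_bigr => i _ do rewrite dt //.
  rewrite sumr_const card_ord => /eqP; rewrite -[t *+ _]mulr_natr -subr_eq0.
  rewrite -[X in _ - X]mul1r -mulrBl mulf_eq0 pnatr_eq0 orbF subr_eq0.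
  by move=> /eqP.
suff -> : diag_mx d = 1%:M by rewrite mulmx1 mulVmx.
by apply/matrixP => i j; rewrite !mxE dt // t1.
Qed.

(* Burnside: an element of the stabilizer is determined by its traces against
   elements of the stabilizer spanning its linear hull, and these traces are
   sums of N-th roots of unity. *)
Lemma stab_finite : exists s : seq 'M[C]_m, uniq s /\ forall A, A \in s <-> stab f A.
Proof.
have [X [XP PX]] := finite_spanning_family (V := 'M[C]_m) (stab f).
have [rs Ers] := closed_field_poly_normal ('X^N - 1%:P : {poly C}).
rewrite lead_coefXnsubC ?stab_exponent_gt0 // scale1r in Ers.
have rsP z : z ^+ N = 1 -> z \in rs.
  by move=> zN; rewrite -root_prod_XsubC -Ers rootE !hornerE zN subrr.
pose K : finType := {ffun 'I_m -> 'I_(size rs)}.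
(* All sums of [m] roots of [X^N - 1]: a finite list containing every trace. *)
pose ts : seq C := [seq \sum_(i < m) rs`_((t : K) i) | t <- enum {: K}].
have tsP A : stab f A -> \tr A \in ts.
  move=> sA; have [P [d [uP -> dN]]] := stab_diagonalizable sA.
  rewrite trace_conj_diag //.
  have ir i : (index (d 0%R i) rs < size rs)%N by rewrite index_mem rsP.
  apply/mapP; exists [ffun i => Ordinal (ir i)]; first by rewrite mem_enum.
  by apply: eq_bigr => i _; rewrite ffunE /= nth_index // rsP.
pose phi (A : 'M[C]_m) : {ffun 'I_(size X) -> 'I_(size ts).+1} :=
  [ffun i : 'I_(size X) => inord (index (\tr (A *m X`_i)) ts)].
apply: (@finite_of_injection _ _ (stab f) phi) => A B sA sB /ffunP eqAB.
have trX i : (i < size X)%N -> \tr (A *m X`_i) = \tr (B *m X`_i).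
  move=> iX; have := eqAB (Ordinal iX); rewrite !ffunE /= => /(congr1 val).
  rewrite /= !inordK ?ltnS ?index_size // => eqi.
  have sX : stab f X`_i by apply: XP; rewrite mem_nth.
  rewrite -(nth_index 0 (tsP _ (stabM sA sX))) eqi nth_index //.
  exact/tsP/stabM.
have trS D : stab f D -> \tr (A *m D) = \tr (B *m D).
  move=> /PX; rewrite -[X]in_tupleE => /coord_span ->.
  rewrite !mulmx_sumr !raddf_sum; apply: eq_bigr => i _ /=.
  by rewrite -!scalemxAr !linearZ /= trX.
have [uB _] := sB.
(* The traces of [A] and [B] against [B^-1] agree, so [A B^-1] has trace [m]. *)
have AB1 : A *m invmx B = 1.
  apply: stab_trace_eq1; first exact: stabM (stabV sB).
  by rewrite trS ?mulmxV ?mxtrace1 //; apply: stabV.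
by rewrite -[A](mulmxKV uB) AB1 mul1mx.
Qed.

End StabilizerFinite.

(** * Virtual characters of a finite matrix group *)

Lemma mxtrace_tens (R : comNzRingType) m n (A : 'M[R]_m) (B : 'M[R]_n) :
  \tr (A *t B) = \tr A * \tr B.
Proof.
rewrite /mxtrace mulr_suml.
under [RHS]eq_bigr => i _ do rewrite mulr_sumr.
rewrite pair_big /= (reindex (@mxtens_index m n)) /=; last first.
  by exists (@mxtens_unindex m n) => i _; rewrite (mxtens_indexK, mxtens_unindexK).
by apply: eq_bigr => -[i j] _; rewrite tensmxE.
Qed.

(** In a rank factorization [P = U V] idempotence forces [V U = 1], and [\tr (U V) = \tr (V U)]. *)
Lemma mxtrace_idempotent (F : fieldType) n (P : 'M[F]_n) :
  P *m P = P -> \tr P = (\rank P)%:R.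
Proof.
move=> PP; rewrite -{1}(mulmx_base P) mxtrace_mulC.
suff -> : row_base P *m col_base P = 1%:M by rewrite mxtrace1.
apply: (row_free_inj (row_base_free P)); rewrite mul1mx.
apply: (row_full_inj (col_base_full P)).
by rewrite -[row_base P *m _ *m _]mulmxA mulmx_base mulmxA mulmx_base PP.
Qed.

Section VirtualCharacters.
Variables (C : numFieldType) (m : nat) (G : seq 'M[C]_m).
Implicit Types chi : 'M[C]_m -> C.

Definition is_rep N (rho : 'M[C]_m -> 'M[C]_N) :=
  {in G &, {morph rho : g h / g *m h}}.

(* [rho 1%:M] need not be the identity: degenerate representations are harmless. *)
Definition is_char chi := exists N (rho : 'M[C]_m -> 'M[C]_N),
  is_rep rho /\ {in G, forall g, chi g = \tr (rho g)}.

Definition is_vchar chi := exists chi1 chi2,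
  [/\ is_char chi1, is_char chi2 & {in G, forall g, chi g = chi1 g - chi2 g}].

Lemma charD chi1 chi2 : is_char chi1 -> is_char chi2 ->
  is_char (fun g => chi1 g + chi2 g).
Proof.
move=> [N1 [r1 [R1 c1]]] [N2 [r2 [R2 c2]]].
exists (N1 + N2)%N, (fun g => block_mx (r1 g) 0 0 (r2 g)); split.
  move=> g h gG hG; rewrite mulmx_block !mulmx0 !mul0mx !addr0 !add0r.
  by rewrite R1 // R2.
by move=> g gG; rewrite mxtrace_block c1 // c2.
Qed.

Lemma charM chi1 chi2 : is_char chi1 -> is_char chi2 ->
  is_char (fun g => chi1 g * chi2 g).
Proof.
move=> [N1 [r1 [R1 c1]]] [N2 [r2 [R2 c2]]].
exists (N1 * N2)%N, (fun g => r1 g *t r2 g); split.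
  by move=> g h gG hG; rewrite R1 // R2 // tensmx_mul.
by move=> g gG; rewrite mxtrace_tens c1 // c2.
Qed.

Lemma char1 : is_char (fun=> 1).
Proof.
exists 1%N, (fun=> 1%:M); split=> [g h _ _|g _]; first by rewrite mulmx1.
by rewrite mxtrace1.
Qed.

Lemma char0 : is_char (fun=> 0).
Proof.
exists 0%N, (fun=> 0); split=> [g h _ _|g _]; first by rewrite mulmx0.
by rewrite mxtrace0.
Qed.

Lemma vchar_ext chi chi' : {in G, chi =1 chi'} -> is_vchar chi -> is_vchar chi'.
Proof.
by move=> E [c1 [c2 [h1 h2 H]]]; exists c1, c2; split=> // g gG; rewrite -E // H.
Qed.

Lemma vchar_char chi : is_char chi -> is_vchar chi.
Proof. by move=> h; exists chi, (fun=> 0); split=> // [|g _]; [exact: char0 | rewrite subr0]. Qed.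

Lemma vcharD chi1 chi2 : is_vchar chi1 -> is_vchar chi2 ->
  is_vchar (fun g => chi1 g + chi2 g).
Proof.
move=> [a [b [ha hb H1]]] [c [d [hc hd H2]]].
exists (fun g => a g + c g), (fun g => b g + d g); split; try exact: charD.
by move=> g gG; rewrite H1 // H2 //; ring.
Qed.

Lemma vcharN chi : is_vchar chi -> is_vchar (fun g => - chi g).
Proof.
by move=> [a [b [ha hb H]]]; exists b, a; split=> // g gG; rewrite H // opprB.
Qed.

Lemma vcharM chi1 chi2 : is_vchar chi1 -> is_vchar chi2 ->
  is_vchar (fun g => chi1 g * chi2 g).
Proof.
move=> [a [b [ha hb H1]]] [c [d [hc hd H2]]].
exists (fun g => a g * c g + b g * d g), (fun g => a g * d g + b g * c g).
split; try by apply: charD; apply: charM.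
by move=> g gG; rewrite H1 // H2 //; ring.
Qed.

Lemma vchar_sum (I : Type) (r : seq I) (P : pred I) (chi : I -> 'M[C]_m -> C) :
  (forall i, P i -> is_vchar (chi i)) -> is_vchar (fun g => \sum_(i <- r | P i) chi i g).
Proof.
move=> H; elim: r => [|i r IH].
  by apply: vchar_ext (vchar_char char0) => g _; rewrite big_nil.
case: (boolP (P i)) => Pi.
  by apply: vchar_ext (vcharD (H i Pi) IH) => g _; rewrite big_cons Pi.
by apply: vchar_ext IH => g _; rewrite big_cons (negbTE Pi).
Qed.

Lemma vchar_prod (I : Type) (r : seq I) (chi : I -> 'M[C]_m -> C) :
  (forall i, is_vchar (chi i)) -> is_vchar (fun g => \prod_(i <- r) chi i g).
Proof.
move=> H; elim: r => [|i r IH].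
  by apply: vchar_ext (vchar_char char1) => g _; rewrite big_nil.
by apply: vchar_ext (vcharM (H i) IH) => g _; rewrite big_cons.
Qed.

Lemma vchar_int (z : int) : is_vchar (fun=> z%:~R).
Proof.
have nat k : is_vchar (fun=> k%:R).
  elim: k => [|k IH]; first exact: vchar_char char0.
  by apply: vchar_ext (vcharD (vchar_char char1) IH) => g _; rewrite -natr1 addrC.
case: z => k; first exact: nat.
by apply: vchar_ext (vcharN (nat k.+1)) => g _; rewrite NegzE rmorphN.
Qed.

Hypothesis G_unit : {in G, forall g, g \in unitmx}.
Hypothesis GM : {in G &, forall g h, g *m h \in G}.
Hypothesis GV : {in G, forall g, invmx g \in G}.
Hypothesis G_uniq : uniq G.

(** The contragredient representation [g |-> rho(g^-1)^T]. *)
Lemma char_invmx chi : is_char chi -> is_char (fun g => chi (invmx g)).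
Proof.
move=> [N [r [R c]]]; exists N, (fun g => (r (invmx g))^T); split.
  move=> g h gG hG; rewrite -trmx_mul -R ?GV //; congr (r _)^T.
  have uh := G_unit hG; have ug := G_unit gG; have ugh := G_unit (GM gG hG).
  apply: (can_inj (mulKmx ugh)); rewrite mulmxV // -mulmxA (mulmxA h) mulmxV //.
  by rewrite mul1mx mulmxV.
by move=> g gG; rewrite mxtrace_tr c // GV.
Qed.

Lemma vchar_invmx chi : is_vchar chi -> is_vchar (fun g => chi (invmx g)).
Proof.
move=> [a [b [ha hb H]]].
exists (fun g => a (invmx g)), (fun g => b (invmx g)); split; try exact: char_invmx.
by move=> g gG; rewrite H // GV.
Qed.

(** The average of [rho] over [G] is idempotent, so its trace is its rank. *)
Lemma char_sum chi : is_char chi ->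
  exists r : nat, \sum_(g <- G) chi g = (r * size G)%:R.
Proof.
move=> [N [rho [R c]]].
case: (posnP (size G)) => [/size0nil -> | G0].
  by exists 0%N; rewrite big_nil.
pose S := \sum_(g <- G) rho g.
have hS h : h \in G -> rho h *m S = S.
  move=> hG; rewrite /S mulmx_sumr big_seq.
  under eq_bigr => g gG do rewrite -R //.
  rewrite -big_seq -(big_map (fun g => h *m g) xpredT rho).
  apply: perm_big; apply: uniq_perm => //.
    by rewrite map_inj_uniq //; apply: can_inj (mulKmx (G_unit hG)).
  move=> g; apply/mapP/idP => [[k kG ->]|gG]; first exact: GM.
  exists (invmx h *m g); first by rewrite GM ?GV.
  by rewrite mulmxA mulmxV ?mul1mx ?G_unit.
have SS : S *m S = (size G)%:R *: S.
  rewrite {1}/S mulmx_suml big_seq.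
  under eq_bigr => g gG do rewrite hS //.
  by rewrite -big_seq big_const_seq count_predT iter_addr_0 scaler_nat.
have sG0 : (size G)%:R != 0 :> C by rewrite pnatr_eq0 -lt0n.
pose P := (size G)%:R^-1 *: S.
have PP : P *m P = P.
  by rewrite /P -scalemxAl -scalemxAr SS !scalerA -mulrA mulVf // mulr1.
exists (\rank P).
have -> : \sum_(g <- G) chi g = \tr S.
  by rewrite raddf_sum big_seq [RHS]big_seq; apply: eq_bigr => g /c.
have -> : S = (size G)%:R *: P by rewrite /P scalerA mulfV // scale1r.
by rewrite linearZ /= mxtrace_idempotent // natrM mulrC.
Qed.

Lemma vchar_sum_int chi : is_vchar chi ->
  exists z : int, \sum_(g <- G) chi g = (z * (size G)%:Z)%:~R.
Proof.
move=> [a [b [/char_sum[ra ha] /char_sum[rb hb] H]]].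
exists (ra%:Z - rb%:Z); rewrite big_seq.
under eq_bigr => g gG do rewrite H //.
by rewrite -big_seq sumrB ha hb mulrBl rmorphB /= -!PoszM -!pmulrn.
Qed.

End VirtualCharacters.

(** * Symmetric powers and their generating series *)

Section SymmetricPowers.
Variables (C : numClosedFieldType) (n L : nat).
Local Notation m := n.+1.
Local Notation T := {ffun 'I_m -> 'I_L.+1}.
Implicit Types (a b c : T) (A B : 'M[C]_m).

Definition expmnm (a : T) : 'X_{1..m} := [multinom nat_of_ord (a i) | i < m].

Lemma expmnm_inj : injective expmnm.
Proof.
move=> a b /mnmP ab; apply/ffunP => i; apply: val_inj.
by have := ab i; rewrite !mnmE.
Qed.

Lemma homog_expand i (p : {mpoly C[m]}) : (i <= L)%N -> p \is i.-homog ->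
  p = \sum_(b : T) p@_(expmnm b) *: 'X_[expmnm b].
Proof.
move=> iL hp; apply/mpolyP => mm; rewrite raddf_sum /=.
under eq_bigr => b _ do rewrite mcoeffZ mcoeffX.
case: (eqVneq (mdeg mm) i) => [mi|ne]; last first.
  rewrite (dhomog_nemf_coeff hp ne) big1 // => b _.
  by case: eqP => [->|_]; rewrite ?(dhomog_nemf_coeff hp ne) ?mul0r ?mulr0.
have mL k : (mm k < L.+1)%N.
  by rewrite ltnS (leq_trans _ iL) // -mi mdegE (bigD1 k) //= leq_addr.
have mE : mm = expmnm [ffun k => Ordinal (mL k)].
  by apply/mnmP => k; rewrite mnmE ffunE.
rewrite (bigD1 [ffun k => Ordinal (mL k)]) //= -mE eqxx mulr1 big1 ?addr0 // => b bne.
by rewrite mE (inj_eq expmnm_inj) (negbTE bne) mulr0.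
Qed.

(** The action on forms of degree [i] in the monomial basis. Rows of other degrees are zero, so all
    [i] share one matrix size; for [i <= L] every monomial of degree [i] is indexed. *)
Definition symrep i A : 'M[C]_#|{: T}| := \matrix_(a, b)
  if mdeg (expmnm (enum_val a)) == i then
    ('X_[expmnm (enum_val a)] \mPo linear_subst A)@_(expmnm (enum_val b))
  else 0.

Lemma linear_subst_homog A i (p : {mpoly C[m]}) :
  p \is i.-homog -> p \mPo linear_subst A \is i.-homog.
Proof.
apply: comp_mpoly_homog => j; rewrite tnth_mktuple; apply: rpred_sum => k _.
by apply: rpredZ; rewrite dhomogX /= mdeg1.
Qed.

Lemma sum_enum_val (F : T -> C) : \sum_(k < #|{: T}|) F (enum_val k) = \sum_a F a.
Proof.
rewrite [RHS](reindex_onto enum_val enum_rank) => [|a _]; last exact: enum_rankK.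
by apply: eq_bigl => k; rewrite enum_valK eqxx.
Qed.

Lemma symrepM i A B : (i <= L)%N -> symrep i (A *m B) = symrep i A *m symrep i B.
Proof.
move=> iL; apply/matrixP => a c; rewrite !mxE.
under eq_bigr => k _ do rewrite !mxE.
case: eqP => [ai|_]; last by rewrite big1 // => k _; rewrite mul0r.
set p := 'X_[_] \mPo linear_subst A.
have hp : p \is i.-homog by apply: linear_subst_homog; rewrite dhomogX /= ai.
rewrite linear_subst_mul -/p {1}(homog_expand iL hp).
rewrite [comp_mpoly _ _]raddf_sum raddf_sum /=.
rewrite (sum_enum_val (fun b => p@_(expmnm b) * (if mdeg (expmnm b) == i then
   ('X_[expmnm b] \mPo linear_subst B)@_(expmnm (enum_val c)) else 0))).
apply: eq_bigr => b _; rewrite comp_mpolyZ mcoeffZ.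
by case: eqP => // /eqP ne; rewrite (dhomog_nemf_coeff hp ne) !mul0r.
Qed.

Lemma symrep_trace_diag i (d : 'rV[C]_m) : \tr (symrep i (diag_mx d)) =
  \sum_(a : T | mdeg (expmnm a) == i) \prod_k d 0 k ^+ a k.
Proof.
rewrite /mxtrace; under eq_bigr => k _ do rewrite mxE.
rewrite (sum_enum_val (fun a => if mdeg (expmnm a) == i then
  ('X_[expmnm a] \mPo linear_subst (diag_mx d))@_(expmnm a) else 0)) -big_mkcond /=.
apply: eq_bigr => a _; rewrite comp_mpolyX.
rewrite (eq_bigr (fun k => d 0 k ^+ a k *: 'X_k ^+ expmnm a k)); last first.
  move=> k _; rewrite tnth_mktuple (bigD1 k) //= big1 ?addr0 => [|j jk].
    by rewrite mxE eqxx mulr1n exprZn mnmE.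
  by rewrite mxE eq_sym (negbTE jk) mulr0n scale0r.
by rewrite scaler_prod -mpolyXE_id mcoeffZ mcoeffX eqxx mulr1.
Qed.

Lemma symrep_trace_conj i (P A : 'M[C]_m) : (i <= L)%N -> P \in unitmx ->
  \tr (symrep i (invmx P *m A *m P)) = \tr (symrep i A).
Proof.
move=> iL uP; have PA : P *m (invmx P *m A) = A by rewrite mulmxA mulmxV // mul1mx.
by rewrite (symrepM _ P iL) [LHS]mxtrace_mulC -(symrepM P _ iL) PA.
Qed.

(** Product of the geometric series of [1 / (1 - d_k t)], each truncated after [t^L]. *)
Definition geo_prod (d : 'rV[C]_m) : {poly C} :=
  \prod_k \sum_(a < L.+1) (d 0 k *: 'X) ^+ a.

Lemma coef_geo_prod (d : 'rV[C]_m) i : (geo_prod d)`_i = \tr (symrep i (diag_mx d)).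
Proof.
rewrite symrep_trace_diag /geo_prod bigA_distr_bigA /= coef_sum [RHS]big_mkcond.
apply: eq_bigr => a _.
rewrite (eq_bigr (fun k => d 0 k ^+ a k *: 'X^(a k))); last by move=> k _; rewrite exprZn.
rewrite scaler_prod prodrXr coefZ coefXn eq_sym mdegE.
rewrite (eq_bigr (fun k => expmnm a k)); last by move=> k _; rewrite mnmE.
by case: eqP => _; rewrite ?mulr1 ?mulr0.
Qed.

(** Congruence to 1 modulo [t^(L+1)]. *)
Definition unit_series (p : {poly C}) := forall i, (i <= L)%N -> p`_i = (i == 0%N)%:R.

Lemma coef_mul_unit_series (p q : {poly C}) i : unit_series q -> (i <= L)%N ->
  (p * q)`_i = p`_i.
Proof.
move=> uq iL; rewrite coefM big_ord_recr /= subnn uq // mulr1 big1 ?add0r // => j _.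
rewrite uq; last by lia.
by rewrite subn_eq0 leqNgt ltn_ord mulr0.
Qed.

Lemma unit_seriesM p q : unit_series p -> unit_series q -> unit_series (p * q).
Proof. by move=> up uq i iL; rewrite coef_mul_unit_series // up. Qed.

Lemma geo_prodK (d : 'rV[C]_m) :
  unit_series ((\prod_k (1 - d 0 k *: 'X)) * geo_prod d).
Proof.
rewrite /geo_prod -big_split /=; elim/big_ind : _ => [i iL||k _].
- by rewrite coef1.
- exact: unit_seriesM.
- have -> : (1 - d 0 k *: 'X) * \sum_(a < L.+1) (d 0 k *: 'X) ^+ a =
      1 - (d 0 k *: 'X) ^+ L.+1 :> {poly C}.
    by rewrite -[RHS]opprB subrX1 -mulNr opprB.
  move=> i iL; rewrite coefB coef1 exprZn coefZ coefXn.
  by rewrite [i == L.+1]ltn_eqF //= mulr0 subr0.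
Qed.

End SymmetricPowers.

(** * The reversed characteristic polynomial *)

Section ReverseCharPoly.
Variables (C : comUnitRingType) (n : nat).

Definition revchar (A : 'M[C]_n) : {poly C} := \det (1%:M - 'X *: map_mx polyC A).

Lemma revchar_conj (P A : 'M[C]_n) : P \in unitmx ->
  revchar (invmx P *m A *m P) = revchar A.
Proof.
move=> uP; rewrite /revchar.
have -> : 1%:M - 'X *: map_mx polyC (invmx P *m A *m P) =
   map_mx polyC (invmx P) *m (1%:M - 'X *: map_mx polyC A) *m map_mx polyC P.
  rewrite mulmxBr mulmxBl mulmx1 -map_mxM mulVmx // map_mx1 -scalemxAr -scalemxAl.
  by rewrite -!map_mxM.
rewrite !det_mulmx mulrC mulrA -det_mulmx -map_mxM mulmxV // map_mx1.
by rewrite det1 mul1r.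
Qed.

Lemma revchar_diag (d : 'rV[C]_n) : revchar (diag_mx d) = \prod_k (1 - d 0 k *: 'X).
Proof.
rewrite /revchar -[1%:M]diag_const_mx map_diag_mx -linearZ -linearB det_diag.
by apply: eq_bigr => k _; rewrite !mxE -mul_polyC mulrC.
Qed.

End ReverseCharPoly.

(** * Eigenvalue multiplicities and the quotient of the two products *)

Section Spectrum.
Variable F : fieldType.

Lemma mxrank_diag n (u : 'rV[F]_n) :
  \rank (diag_mx u) = (\sum_k (u 0%R k != 0%R))%N.
Proof.
elim: n u => [|n IH] u; first by rewrite thinmx0 mxrank0 big_ord0.
have -> : diag_mx u = block_mx (diag_mx (lsubmx (u : 'rV_(1 + n)))) 0 0
    (diag_mx (rsubmx (u : 'rV_(1 + n)))) by rewrite -diag_mx_row hsubmxK.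
rewrite big_ord_recl (@rank_diag_block_mx _ 1 1) IH.
congr (_ + _)%N.
  rewrite [diag_mx _]mx11_scalar rank_rV !mxE eqxx mulr1n.
  have -> : lshift n (0 : 'I_1) = 0 by apply: val_inj.
  congr (nat_of_bool (~~ _)); apply/eqP/eqP => [/matrixP/(_ 0 0)|->]; last exact: raddf0.
  by rewrite !mxE eqxx mulr1n.
by apply: eq_bigr => k _; rewrite !mxE; congr (nat_of_bool (u _ _ != 0)); apply: val_inj.
Qed.

Lemma rank_eigenspace_diag n (P : 'M[F]_n) (d : 'rV[F]_n) z : P \in unitmx ->
  \rank (eigenspace (invmx P *m diag_mx d *m P) z) = (\sum_k (d 0%R k == z))%N.
Proof.
move=> uP; rewrite /eigenspace mxrank_ker.
have -> : invmx P *m diag_mx d *m P - z%:M = invmx P *m diag_mx (d - const_mx z) *m P.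
  by rewrite linearB /= mulmxBr mulmxBl diag_const_mx mul_mx_scalar -scalemxAl mulVmx // scalemx1.
rewrite mxrankMfree ?row_free_unit // eqmxMfull ?row_full_unit ?unitmx_inv //.
set u := d - const_mx z; rewrite mxrank_diag -{1}[n]card_ord -sum1_card.
apply/eqP; rewrite -(eqn_add2r (\sum_k (u 0%R k != 0%R))%N) subnK.
  rewrite -big_split; apply/eqP; apply: eq_bigr => k _ /=.
  by rewrite !mxE subr_eq0; case: eqP.
by apply: leq_sum => k _; case: (_ != _).
Qed.

Lemma prod_XsubC_dvdp_mup (s : seq F) (p : {poly F}) : p != 0 ->
  (forall x, count_mem x s <= mup x p)%N -> \prod_(x <- s) ('X - x%:P) %| p.
Proof.
elim: s p => [|y s IH] p p0 H; first by rewrite big_nil dvd1p.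
have : 'X - y%:P %| p.
  by rewrite XsubC_dvd //; apply: leq_trans (H y); rewrite /= eqxx.
case/dvdpP => q pq; rewrite big_cons pq mulrC dvdp_mul2r ?polyXsubC_eq0 //.
have q0 : q != 0 by apply: contra p0 => /eqP q0; rewrite pq q0 mul0r.
apply: IH => // x; have := H x.
rewrite pq mupM ?polyXsubC_eq0 // (@mup_XsubCX _ 1) /= addnC.
by rewrite leq_add2r.
Qed.

Variables (m e : nat) (d : 'rV[F]_m).
Hypothesis d_neq0 : forall k, d 0 k != 0.
Hypothesis e_gt0 : (0 < e)%N.

(** At [x = z^-1] the left side has a zero of order the number of [k] with [d_k = z]; the factors on
    the right vanishing there are those with [d_k = x^e = z^-e], at least as many. *)
Lemma reverse_charpoly_dvdp :
    (forall z, \sum_k (d 0%R k == z) <= \sum_k (d 0%R k == (z^-1 ^+ e)%R))%N ->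
  \prod_k (1 - d 0 k *: 'X) %| \prod_k (1 - (d 0 k)^-1 *: 'X^e).
Proof.
move=> cnt; set p := (X in _ %| X).
have p0 : p != 0.
  apply/prodf_neq0 => k _; apply/eqP => /(congr1 (horner^~ 0)).
  by rewrite !hornerE expr0n eqn0Ngt e_gt0 mulr0 subr0 => /eqP; rewrite oner_eq0.
pose s := [seq (d 0 k)^-1 | k <- enum 'I_m].
have -> : \prod_k (1 - d 0 k *: 'X) =
    (\prod_k - d 0 k) *: \prod_(x <- s) ('X - x%:P) :> {poly F}.
  rewrite /s big_map big_enum -scaler_prod; apply: eq_bigr => k _.
  by rewrite scalerBr !scaleNr opprK -[_ *: _%:P]mul_polyC -polyCM mulfV // addrC.
rewrite dvdpZl; last by apply/prodf_neq0 => k _; rewrite oppr_eq0.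
apply: prod_XsubC_dvdp_mup => // x.
have -> : count_mem x s = (\sum_k (d 0%R k == x^-1%R))%N.
  rewrite /s count_map -sum1_count big_mkcond big_enum /=.
  by apply: eq_bigr => k _; rewrite (can2_eq invrK invrK); case: eqP.
apply: leq_trans (cnt _) _; rewrite invrK mup_geq // -prodrXr /p.
elim/big_ind2 : _ => [||k _]; [exact: dvdpp | by move=> *; apply: dvdp_mul |].
case: eqP => [dx|_]; last by rewrite expr0 dvd1p.
by rewrite expr1 dvdp_XsubCl rootE !hornerE -dx mulVf // subrr.
Qed.

(** After one factor [1 - t] is cancelled for each [d_k = 1], the value at 1 gets a factor [e] from
    each such [k] and [(1 - 1/d_k) / (1 - d_k) = -1/d_k] from every other one. *)
Lemma reverse_charpoly_quotient_at1 (Q : {poly F}) :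
    \prod_k (1 - (d 0 k)^-1 *: 'X^e) = \prod_k (1 - d 0 k *: 'X) * Q ->
  Q.[1] * \prod_k d 0 k = (-1) ^+ m * (- e%:R) ^+ (\sum_k (d 0%R k == 1%R))%N.
Proof.
move=> EQ.
pose g : {poly F} := \sum_(i < e) 'X^i.
pose c k : {poly F} := if d 0 k == 1 then 1 - 'X else 1.
pose a k : {poly F} := if d 0 k == 1 then 1 else 1 - d 0 k *: 'X.
pose b k : {poly F} := if d 0 k == 1 then g else 1 - (d 0 k)^-1 *: 'X^e.
have aE k : 1 - d 0 k *: 'X = c k * a k.
  by rewrite /c /a; case: eqP => [->|_]; rewrite ?scale1r ?mulr1 ?mul1r.
have bE k : 1 - (d 0 k)^-1 *: 'X^e = c k * b k.
  rewrite /c /b; case: eqP => [->|_]; rewrite ?mul1r // invr1 scale1r.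
  by rewrite -[LHS]opprB subrX1 -mulNr opprB.
have c0 : \prod_k c k != 0.
  apply/prodf_neq0 => k _; rewrite /c; case: (d 0 k == 1); last exact: oner_neq0.
  by rewrite -opprB oppr_eq0 -polyC1 polyXsubC_eq0.
have {}EQ : \prod_k b k = \prod_k a k * Q.
  apply: (mulfI c0); rewrite mulrA -!big_split /=.
  by rewrite -(eq_bigr _ (fun k _ => aE k)) -(eq_bigr _ (fun k _ => bE k)).
have g1 : g.[1] = e%:R.
  rewrite /g horner_sum; under eq_bigr => i _ do rewrite hornerXn expr1n.
  by rewrite sumr_const card_ord.
have a1 k : (a k).[1] != 0.
  rewrite /a; case: (eqVneq (d 0 k) 1) => [_|dk]; first by rewrite hornerE oner_neq0.
  by rewrite !hornerE subr_eq0 eq_sym.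
have ab k : (b k).[1] * d 0 k = (a k).[1] * (- (- e%:R) ^+ (d 0 k == 1)).
  rewrite /a /b; case: (eqVneq (d 0 k) 1) => [->|_] /=.
    by rewrite g1 !hornerE opprK.
  by rewrite !hornerE expr1n mulr1 mulrN1 mulrBl mul1r mulVf // opprB.
have a0 : \prod_k (a k).[1] != 0 by apply/prodf_neq0 => k _.
have EQ1 : \prod_k (a k).[1] * Q.[1] = \prod_k (b k).[1].
  by rewrite -!horner_prod -hornerM -EQ.
apply: (mulfI a0); rewrite mulrA EQ1 -big_split /=.
rewrite (eq_bigr _ (fun k _ => ab k)) big_split /=; congr (_ * _).
rewrite (eq_bigr (fun k => -1 * (- e%:R) ^+ (d 0 k == 1))); last by move=> k _; rewrite mulN1r.
by rewrite big_split /= prodrXr prodr_const card_ord.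
Qed.

End Spectrum.

(** * The Milnor character and the order of the stabilizer *)

Section Main.
Variables (C : numClosedFieldType) (n e : nat).
Local Notation m := n.+1.
Variable f : {mpoly C[m]}.
Hypothesis hf : f \is e.+1.-homog.
Hypothesis hsmooth : forall x : 'I_m -> C,
  (forall i, (f^`M(i)).@[x] = 0) -> forall j, x j = 0.
Hypothesis e1 : (1 < e)%N.
Variable G : seq 'M[C]_m.
Hypothesis G_uniq : uniq G.
Hypothesis GE : forall A, A \in G <-> stab f A.

Let GM : {in G &, forall g h, g *m h \in G}.
Proof. by move=> g h /GE sg /GE sh; apply/GE/stabM. Qed.
Let GV : {in G, forall g, invmx g \in G}.
Proof. by move=> g /GE sg; apply/GE/stabV. Qed.
Let Gu : {in G, forall g, g \in unitmx}.
Proof. by move=> g /GE[]. Qed.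

Local Notation L := (m * e)%N.
Local Notation h := (fun i g => \tr (symrep L i g)).

Lemma vchar_symrep i : (i <= L)%N -> is_vchar G (h i).
Proof.
move=> iL; apply: vchar_char; exists _, (symrep L i); split=> // g k _ _.
exact: symrepM.
Qed.

(** Coefficients up to degree [L] of [det (1 - t g) * sum_i h_i(g) t^i = 1]. *)
Lemma revchar_series g i : g \in G -> (i <= L)%N ->
  \sum_(j < i.+1) (revchar g)`_j * h (i - j)%N g = (i == 0%N)%:R.
Proof.
move=> /GE/(stab_diagonalizable hf hsmooth e1)[P [d [uP -> _]]] iL.
rewrite revchar_conj // revchar_diag -(geo_prodK d iL) coefM.
apply: eq_bigr => j _; rewrite coef_geo_prod symrep_trace_conj //.
exact: leq_trans (leq_subr _ _) iL.
Qed.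

Lemma revchar_coef0 (g : 'M[C]_m) : (revchar g)`_0 = 1.
Proof.
rewrite -horner_coef0 /revchar -horner_evalE -det_map_mx.
suff -> : map_mx (horner_eval 0) (1%:M - 'X *: map_mx polyC g) = 1%:M :> 'M[C]_m.
  by rewrite det1.
apply/matrixP => i j; rewrite !mxE horner_evalE !hornerE.
by rewrite subr0; case: (i == j); rewrite ?hornerC ?hornerE.
Qed.

(** The series identity, solved for its last term, expresses each coefficient through earlier ones
    and characters of symmetric powers, with integer coefficients. *)
Lemma vchar_revchar i : (i <= L)%N -> is_vchar G (fun g => (revchar g)`_i).
Proof.
elim/ltn_ind: i => -[|i] IH iL.
  by apply: vchar_ext (vchar_char (char1 G)) => g _; rewrite revchar_coef0.
have vs : is_vchar G (fun g => \sum_(j < i.+1) (revchar g)`_j * h (i.+1 - j)%N g).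
  apply: vchar_sum => j _; apply: vcharM.
    by apply: IH => //; apply: ltnW; apply: leq_trans iL.
  by apply: vchar_symrep; apply: leq_trans (leq_subr _ _) iL.
apply: vchar_ext (vcharN vs) => g gG /=.
have h0 : h 0%N g = 1.
  have := revchar_series gG (leq0n _).
  by rewrite big_ord_recl big_ord0 addr0 /= revchar_coef0 mul1r.
have := revchar_series gG iL; rewrite big_ord_recr /= subnn h0 mulr1 => /eqP.
by rewrite addr_eq0 => /eqP->; rewrite opprK.
Qed.

(* The sum over [j] is the coefficient of [t^i] in
   [det (1 - t^e g^-1) / det (1 - t g)], a polynomial of degree at most [L]. *)
Definition milnor_char (g : 'M[C]_m) := \sum_(i < L.+1) \sum_(j < i.+1)
  (revchar (invmx g) \Po 'X^e)`_j * h (i - j)%N g.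

Lemma vchar_milnor : is_vchar G milnor_char.
Proof.
apply: vchar_sum => i _; apply: vchar_sum => j _; apply: vcharM; last first.
  by apply: vchar_symrep; apply: leq_trans (leq_subr _ _) _; rewrite -ltnS.
apply: vchar_ext (_ : is_vchar G (fun g => if (e %| j)%N then (revchar (invmx g))`_(j %/ e) else 0)).
  by move=> g _; rewrite coef_comp_poly_Xn //; apply: ltnW.
case: (e %| j)%N; last exact: vchar_char (char0 G).
apply: (vchar_invmx Gu GM GV (chi := fun g => (revchar g)`_(j %/ e))).
apply: vchar_revchar; apply: leq_trans (leq_div _ _) _.
by have := ltn_ord i; have := ltn_ord j; lia.
Qed.

Definition fixdim (g : 'M[C]_m) := \rank (eigenspace g 1).

(** The eigenspace inequalities make the quotient a polynomial [Q], and [milnor_char g] is the sum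
    [Q(1)] of its coefficients. *)
Lemma milnor_charE g : g \in G ->
  milnor_char g * \det g = (-1) ^+ m * (- e%:R) ^+ fixdim g.
Proof.
move=> /GE sg; have e0 : (0 < e)%N by apply: ltnW.
have rk z := rank_eigenspace_le hf hsmooth z e0 sg.
have [P [d [uP gE _]]] := stab_diagonalizable hf hsmooth e1 sg.
have dg : \det g = \prod_k d 0 k.
  rewrite gE !det_mulmx det_diag mulrC mulrA -det_mulmx mulmxV // det1 mul1r //.
have d0 k : d 0 k != 0.
  have : \det g != 0 by case: sg => + _; rewrite unitmxE unitfE.
  by rewrite dg => /prodf_neq0/(_ k isT).
have cnt z : (\sum_k (d 0%R k == z) <= \sum_k (d 0%R k == (z^-1 ^+ e)%R))%N.
  by have := rk z; rewrite gE !rank_eigenspace_diag.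
have gV : invmx g = invmx P *m diag_mx (\row_k (d 0 k)^-1) *m P.
  have [ug _] := sg; apply: (can_inj (mulKmx ug)); rewrite mulmxV // gE.
  rewrite !mulmxA mulmxK // -[invmx P *m _ *m _]mulmxA mulmx_diag.
  rewrite (_ : \row_j _ = const_mx 1) ?diag_const_mx ?mulmx1 ?mulVmx //.
  by apply/rowP => k; rewrite !mxE mulfV.
have RV : revchar (invmx g) \Po 'X^e = \prod_k (1 - (d 0 k)^-1 *: 'X^e).
  rewrite gV revchar_conj // revchar_diag rmorph_prod; apply: eq_bigr => k _ /=.
  by rewrite comp_polyB comp_polyC comp_polyZ comp_polyX mxE.
have /dvdpP[Q EQ] := reverse_charpoly_dvdp d0 e0 cnt.
rewrite mulrC in EQ.
have := reverse_charpoly_quotient_at1 d0 EQ.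
rewrite -dg /fixdim gE rank_eigenspace_diag // -gE => <-; congr (_ * _).
(* The numerator has degree at most [m * e = L], so the sum up to [L] misses no coefficient of
   [Q]. *)
have szQ : (size Q <= L.+1)%N.
  have p0 : \prod_k (1 - (d 0 k)^-1 *: 'X^e) != 0 :> {poly C}.
    apply/prodf_neq0 => k _; apply/eqP => /(congr1 (horner^~ 0)).
    by rewrite !hornerE expr0n eqn0Ngt e0 mulr0 subr0 => /eqP; rewrite oner_eq0.
  have QB : Q %| \prod_k (1 - (d 0 k)^-1 *: 'X^e) by rewrite EQ dvdp_mull.
  apply: leq_trans (dvdp_leq p0 QB) _.
  apply: leq_trans (size_poly_prod_leq _ _) _.
  rewrite card_ord leq_subLR addnS ltnS.
  apply: leq_trans (_ : \sum_(k < m) e.+1 <= _)%N; last first.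
    by rewrite sum_nat_const card_ord mulnS.
  apply: leq_sum => k _; apply: leq_trans (size_polyD _ _) _.
  rewrite size_poly1 geq_max ltnS leq0n size_polyN.
  by apply: leq_trans (size_scale_leq _ _) _; rewrite size_polyXn.
rewrite (horner_coef_wide _ szQ); apply: eq_bigr => i _; rewrite expr1n mulr1.
have iL : (i <= L)%N by rewrite -ltnS.
(* The denominator times [geo_prod] is 1 up to degree [L], so there [Q] agrees with the numerator
   times [geo_prod]. *)
rewrite -(coef_mul_unit_series Q (geo_prodK (L := L) d) iL) mulrA [Q * _]mulrC -EQ -RV coefM.
apply: eq_bigr => j _; rewrite coef_geo_prod gE symrep_trace_conj //.
exact: leq_trans (leq_subr _ _) iL.
Qed.

(** Multiplying [milnor_char] by the determinant and by the constant [(-1) ^ m] leaves exactly this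
    power. *)
Lemma vchar_fixdim : is_vchar G (fun g => (- e%:R) ^+ fixdim g).
Proof.
have vdet : is_vchar G (fun g => \det g).
  apply: vchar_char; exists 1%N, (fun g => (\det g)%:M); split=> [g k _ _|g _].
    by rewrite det_mulmx scalar_mxM.
  by rewrite mxtrace_scalar.
have := vcharM (vchar_int G ((-1) ^+ m)) (vcharM vchar_milnor vdet).
apply: vchar_ext => g gG; rewrite milnor_charE // mulrA.
by rewrite rmorphXn /= rmorphN1 -exprMn mulrNN mulr1 expr1n mul1r.
Qed.

Lemma fixdim1 : fixdim 1%:M = m.
Proof. by rewrite /fixdim /eigenspace subrr mxrank_ker mxrank0 subn0. Qed.

Lemma fixdim_lt g : g != 1%:M -> (fixdim g < m)%N.
Proof.
move=> g1; rewrite /fixdim /eigenspace mxrank_ker ltn_subrL /= lt0n mxrank_eq0.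
by rewrite subr_eq0 g1.
Qed.

Lemma card_stab_dvd :
  ((size G)%:Z %| \prod_(j < m) ((- e%:Z) ^+ m - (- e%:Z) ^+ j))%Z.
Proof.
set q := - e%:Z.
pose theta (g : 'M[C]_m) := \prod_(j < m) ((- e%:R) ^+ fixdim g - (q ^+ j)%:~R) : C.
have vt : is_vchar G theta.
  apply: vchar_prod => j; apply: vcharD vchar_fixdim _.
  exact: vcharN (vchar_int G _).
have [z Ez] := vchar_sum_int Gu GM GV G_uniq vt.
have G1 : 1%:M \in G by apply/GE/stab1.
apply/dvdzP; exists z; apply: (@intr_inj C); rewrite -Ez.
rewrite (bigD1_seq 1%:M) //= [X in _ + X]big1 ?addr0 => [|g g1].
  rewrite rmorph_prod /theta fixdim1; apply: eq_bigr => j _ /=.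
  by rewrite rmorphB /= !rmorphXn /= rmorphN.
(* As [fixdim g < m], the factor of index [fixdim g] occurs in the product, and it is zero. *)
rewrite /theta (bigD1 (Ordinal (fixdim_lt g1))) //=.
by rewrite rmorphXn /= rmorphN /= subrr mul0r.
Qed.

End Main.

(** * Comparison with the stated bound *)

Lemma bound_dvd (k : int) n e :
  (k %| \prod_(j < n.+1) ((- e%:Z) ^+ n.+1 - (- e%:Z) ^+ j))%Z ->
  (k %| bound n e.+1)%Z.
Proof.
(* Each factor on the left is [(-1) ^ n.+1] times the factor of the same index in [bound], whence
   the total sign. *)
have -> : \prod_(j < n.+1) ((- e%:Z) ^+ n.+1 - (- e%:Z) ^+ j) =
    (-1) ^+ (n.+1 * n.+1) * bound n e.+1.
  rewrite exprM; have -> : (-1) ^+ n.+1 ^+ n.+1 = \prod_(j < n.+1) (-1) ^+ n.+1 :> int.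
    by rewrite prodr_const card_ord.
  rewrite /bound -big_split; apply: eq_bigr => j _ /=.
  have -> : e.+1%:Z - 1 = e%:Z by lia.
  move: (nat_of_ord j) (ltn_ord j) => {}j jn.
  have -> : n.+1 = (n - j + 1 + j)%N by lia.
  rewrite !exprD !expr1 !(exprNn e%:Z); set s := (-1) ^+ (n - j).
  have ss : s * s = 1 by rewrite -expr2 sqrr_sign.
  set t := (-1) ^+ j; set x := e%:Z ^+ (n - j); set y := e%:Z ^+ j.
  have -> : s * -1 * t * ((s + x * e%:Z) * y) = (- (s * s) - s * x * e%:Z) * t * y by ring.
  by rewrite ss; ring.
move=> H; rewrite -[bound _ _]mul1r -(sqrr_sign _ (n.+1 * n.+1)%N) expr2 -mulrA.
exact: dvdz_mull.
Qed.

Theorem theorem2 (n d : nat) (f : {mpoly CC[n.+1]})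
  (hd : (2 < d)%N)
  (hf : f \is d.-homog)
  (hsmooth : forall x : 'I_n.+1 -> CC,
      (forall i : 'I_n.+1, (f^`M(i)).@[x] = 0) -> forall j, x j = 0) :
  exists s : seq 'M[CC]_n.+1,
    [/\ uniq s,
        (forall A : 'M[CC]_n.+1,
            A \in s <-> (A \in unitmx /\ comp_lin f A = f))
      & ((size s)%:Z %| bound n d)%Z].
Proof.
(* With [d = e.+1] the hypothesis [2 < d] becomes [1 < e]; [comp_lin f A] is convertible to
   [f \mPo linear_subst A]. *)
case: d hd hf => [//|e] e1 hf.
have [s [us sE]] := @stab_finite (complex Rdefinitions.R) n e f hf hsmooth e1.
exists s; split=> //; apply: bound_dvd.
exact: (@card_stab_dvd (complex Rdefinitions.R) n e f hf hsmooth e1 s us sE).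
Qed.
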